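(* Let $\ell$ and $p$ be distinct primes, let $\Gamma$ be an abelian pro-$p$-group, and let $\Lambda=\mathbb{Z}_\ell[[\Gamma]]$. Let $\mathscr{R}=\Gamma^\vee/G_{\mathbb{Q}_\ell}$ be the set of orbits $[\omega]$ of continuous characters $\omega$ of $\Gamma$ under the absolute Galois group of $\mathbb{Q}_\ell$. Then there are (non-canonical) ring isomorphisms $$\Lambda\simeq \prod_{[\omega]\in \mathscr{R}} \mathbb{Z}_\ell[\omega(\Gamma)]\simeq \prod_{n\geqslant 0}\ \prod_{\substack{[\omega]\in \mathscr{R}\\ \omega(\Gamma)=\boldsymbol{\mu}_{p^n}}} \mathbb{Z}_\ell[\boldsymbol{\mu}_{p^n}].$$
   Context: $\Lambda=\mathbb{Z}_\ell[[\Gamma]]=\varprojlim \mathbb{Z}_\ell[\Gamma/U]$, the limit over the open subgroups $U$ of $\Gamma$ (equivalently, $\Gamma=\varprojlim\Gamma_n$ with $\Gamma_n$ finite abelian $p$-groups and $\Lambda=\varprojlim\mathbb{Z}_\ell[\Gamma_n]$). Fix an embedding $\overline{\mathbb{Q}}\hookrightarrow\overline{\mathbb{Q}}_\ell$. $\Gamma^\vee=\mathrm{Hom}_{cont}(\Gamma,\boldsymbol{\mu})$, where $\boldsymbol{\mu}\subset\overline{\mathbb{Q}}\subset\overline{\mathbb{Q}}_\ell$ is the group of roots of unity with the discrete topology. $G_{\mathbb{Q}_\ell}=\mathrm{Gal}(\overline{\mathbb{Q}}_\ell/\mathbb{Q}_\ell)$ acts on $\Gamma^\vee$ by $(\sigma\cdot\omega)(\gamma)=\sigma(\omega(\gamma))$.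 The image $\omega(\Gamma)$ depends only on the orbit $[\omega]$. $\boldsymbol{\mu}_{p^n}$ is the group of $p^n$-th roots of unity in $\overline{\mathbb{Q}}_\ell$, and $\mathbb{Z}_\ell[\omega(\Gamma)]\subset\overline{\mathbb{Q}}_\ell$ is the subring generated by $\omega(\Gamma)$ over $\mathbb{Z}_\ell$. *)

(* Defs.v *)
From HB Require Import structures.
From mathcomp Require Import all_boot all_order all_algebra.
From mathcomp Require Import finmap.
From mathcomp Require Import all_classical topology tvs.

Set Implicit Arguments.
Unset Strict Implicit.
Unset Printing Implicit Defensive.

Import GRing.Theory.

Local Open Scope classical_set_scope.
Local Open Scope ring_scope.
Local Open Scope quotient_scope.

(* comPzRingType rather than comNzRingType: the empty product is the zero     *)
(* ring.                                                                      *)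

Definition dprod (I : Type) (A : I -> comPzRingType) : Type := forall i, A i.

Section DependentProduct.
Variables (I : Type) (A : I -> comPzRingType).
Implicit Types x y z : dprod A.

HB.instance Definition _ := Choice.copy (dprod A) (forall i, A i).

Let zero : dprod A := fun=> 0.
Let one : dprod A := fun=> 1.
Let opp x : dprod A := fun i => - x i.
Let add x y : dprod A := fun i => x i + y i.
Let mul x y : dprod A := fun i => x i * y i.

Let addA : associative add.
Proof. by move=> x y z; apply: functional_extensionality_dep => i; exact: addrA. Qed.
Let addC : commutative add.
Proof. by move=> x y; apply: functional_extensionality_dep => i; exact: addrC. Qed.
Let add0 : left_id zero add.
Proof. by move=> x; apply: functional_extensionality_dep => i; exact: add0r. Qed.
Let addN : left_inverse zero opp add.
Proof. by move=> x; apply: functional_extensionality_dep => i; exact: addNr. Qed.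
Let mulA : associative mul.
Proof. by move=> x y z; apply: functional_extensionality_dep => i; exact: mulrA. Qed.
Let mulC : commutative mul.
Proof. by move=> x y; apply: functional_extensionality_dep => i; exact: mulrC. Qed.
Let mul1 : left_id one mul.
Proof. by move=> x; apply: functional_extensionality_dep => i; exact: mul1r. Qed.
Let mulD : left_distributive mul add.
Proof. by move=> x y z; apply: functional_extensionality_dep => i; exact: mulrDl. Qed.

HB.instance Definition _ := GRing.isZmodule.Build (dprod A) addA addC add0 addN.
HB.instance Definition _ :=
  GRing.Zmodule_isComPzRing.Build (dprod A) mulA mulC mul1 mulD.

Lemma dprodP x y : (forall i, x i = y i) -> x = y.
Proof. exact: functional_extensionality_dep. Qed.
Lemma dprod0E i : (0 : dprod A) i = 0. Proof. by []. Qed.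
Lemma dprod1E i : (1 : dprod A) i = 1. Proof. by []. Qed.
Lemma dprodNE x i : (- x) i = - x i. Proof. by []. Qed.
Lemma dprodDE x y i : (x + y) i = x i + y i. Proof. by []. Qed.
Lemma dprodBE x y i : (x - y) i = x i - y i. Proof. by []. Qed.
Lemma dprodME x y i : (x * y) i = x i * y i. Proof. by []. Qed.

End DependentProduct.

Section InverseLimit.
Variables (I : Type) (le : I -> I -> Prop) (A : I -> comPzRingType).
Variable phi : forall i j, le i j -> {rmorphism A j -> A i}.

Definition compatible : {pred dprod A} :=
  fun x => `[< forall i j (le_ij : le i j), phi le_ij (x j) = x i >].

Lemma compatibleP (x : dprod A) :
  reflect (forall i j (le_ij : le i j), phi le_ij (x j) = x i)
          (x \in compatible).
Proof. exact: asboolP. Qed.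

Lemma compatible_subring_closed : subring_closed compatible.
Proof.
split=> [|x y /compatibleP cx /compatibleP cy|x y /compatibleP cx /compatibleP cy].
- by apply/compatibleP => i j le_ij; rewrite dprod1E rmorph1.
- by apply/compatibleP => i j le_ij; rewrite !dprodBE rmorphB cx cy.
- by apply/compatibleP => i j le_ij; rewrite !dprodME rmorphM cx cy.
Qed.

HB.instance Definition _ :=
  GRing.isSubringClosed.Build (dprod A) compatible compatible_subring_closed.

Record invlim := InvLim {
  invlim_val :> dprod A;
  invlim_valP : invlim_val \in compatible
}.

HB.instance Definition _ := [isSub for invlim_val].
HB.instance Definition _ := [Choice of invlim by <:].
HB.instance Definition _ := GRing.SubChoice_isSubComPzRing.Build
  (dprod A) compatible invlim compatible_subring_closed.

End InverseLimit.

Lemma fsum_neq0 (M : nmodType) (T : choiceType) (P : set T) (F : T -> M) :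
  \sum_(x \in P) F x <> 0 -> exists2 x, P x & F x <> 0.
Proof.
move=> nz; apply: contrapT => noF; apply: nz; apply: fsbig1 => x Px.
by apply: contrapT => Fx; apply: noF; exists x.
Qed.

(* The group ring A[G] of an additively written abelian group G: finitely     *)
(* supported functions G -> A under convolution.                              *)

Section GroupRing.
Variables (A : comPzRingType) (G : zmodType).

Definition finite_supp : {pred G -> A} :=
  fun f => `[< finite_set (f @^-1` [set~ 0]) >].

Lemma finite_suppP (f : G -> A) :
  reflect (finite_set (f @^-1` [set~ 0])) (f \in finite_supp).
Proof. exact: asboolP. Qed.

Lemma finite_supp_zmod_closed : zmod_closed finite_supp.
Proof.
split=> [|f g /finite_suppP ff /finite_suppP fg]; apply/finite_suppP.
  by apply: (@sub_finite_set _ _ set0) => // x /=.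
have ffg : finite_set ((f @^-1` [set~ 0]) `|` (g @^-1` [set~ 0])).
  by rewrite finite_setU.
apply: sub_finite_set ffg => x /= nz.
have [fx0|] := pselect (f x = 0); last by left.
right=> gx0; apply: nz.
by rewrite (_ : (f - g) x = f x - g x)// fx0 gx0 subr0.
Qed.

HB.instance Definition _ :=
  GRing.isZmodClosed.Build (G -> A) finite_supp finite_supp_zmod_closed.

Record group_ring := GroupRing {
  gr_fun :> G -> A;
  gr_funP : gr_fun \in finite_supp
}.

HB.instance Definition _ := [isSub for gr_fun].
HB.instance Definition _ := [Choice of group_ring by <:].
HB.instance Definition _ := [SubChoice_isSubZmodule of group_ring by <:].

Implicit Types f g h : group_ring.

Lemma grP f g : (forall x, f x = g x) -> f = g.
Proof. by move=> fg; apply/val_inj/funext. Qed.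

Lemma gr0E x : (0 : group_ring) x = 0. Proof. by []. Qed.
Lemma grDE f g x : (f + g) x = f x + g x. Proof. by []. Qed.

Lemma gr_finite f : finite_set (f @^-1` [set~ 0]).
Proof. exact/finite_suppP/gr_funP. Qed.

Lemma gr_delta_subproof (a : A) (k : G) :
  (fun x => if x == k then a else 0) \in finite_supp.
Proof.
apply/finite_suppP; apply: (@sub_finite_set _ _ [set k]) => // x /=.
by case: eqP.
Qed.

Definition gr_delta a k : group_ring := GroupRing (gr_delta_subproof a k).

Lemma gr_deltaE a k x : gr_delta a k x = if x == k then a else 0.
Proof. by []. Qed.

Lemma gr_delta_decomp f :
  f = \sum_(k <- fset_set (f @^-1` [set~ 0])) gr_delta (f k) k.
Proof.
apply: grP => x.
have -> : (\sum_(k <- fset_set (f @^-1` [set~ 0])) gr_delta (f k) k) x =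
    \sum_(k <- fset_set (f @^-1` [set~ 0])) gr_delta (f k) k x.
  by elim/big_rec2: _ => // k _ u _ <-.
have [fx0|fx0] := pselect (f x = 0).
  by rewrite big1 ?fx0// => k _; rewrite gr_deltaE; case: eqP => // <-.
rewrite (bigD1_seq x)/= ?fset_uniq//; last first.
  by rewrite in_fset_set ?inE//; exact: gr_finite.
rewrite eqxx big1 ?addr0// => k kx.
by rewrite eq_sym (negPf kx).
Qed.

Lemma gr_ind (P : group_ring -> Prop) :
  P 0 -> (forall f g, P f -> P g -> P (f + g)) ->
  (forall a k, P (gr_delta a k)) -> forall f, P f.
Proof.
move=> P0 PD Pd f; rewrite [f]gr_delta_decomp.
by elim/big_ind: _ => // k _; exact: Pd.
Qed.

Definition conv (f g : G -> A) : G -> A :=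
  fun z => \sum_(x \in [set: G]) f x * g (z - x).

Lemma convC (f g : G -> A) : conv f g = conv g f.
Proof.
apply/funext => z; rewrite /conv (reindex_fsbigT (fun x => z - x)); last first.
  by exists (fun x => z - x); exact: subKr.
by apply: eq_fsbigr => x _; rewrite subKr mulrC.
Qed.

Lemma convEw (D : set G) (f g : G -> A) z :
  finite_set D -> f @^-1` [set~ 0] `<=` D ->
  conv f g z = \sum_(x <- fset_set D) f x * g (z - x).
Proof.
move=> finD suppD; rewrite /conv -fsbig_finite//; apply/esym/fsbig_widen => //.
move=> x [_ nDx] /=; have [->|/suppD//] := pselect (f x = 0).
by rewrite mul0r.
Qed.

Lemma conv_subproof f g : conv f g \in finite_supp.
Proof.
apply/finite_suppP; apply: (@sub_finite_set _ _
  ((fun u : G * G => u.1 + u.2) @` ((f @^-1` [set~ 0]) `*` (g @^-1` [set~ 0])))).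
  move=> z /= /fsum_neq0[x _ nz]; exists (x, z - x).
    by split=> /= e; apply: nz; rewrite e ?mul0r ?mulr0.
  by rewrite /= addrC subrK.
by apply: finite_image; apply: finite_setX; exact: gr_finite.
Qed.

Definition gr_mul f g := GroupRing (conv_subproof f g).

Lemma gr_mulE f g z : gr_mul f g z = conv f g z. Proof. by []. Qed.

Lemma gr_mulC : commutative gr_mul.
Proof. by move=> f g; apply: val_inj => /=; exact: convC. Qed.

Lemma gr_mulDl : left_distributive gr_mul +%R.
Proof.
move=> f g h; apply: grP => z; rewrite grDE !gr_mulE.
pose D := (f @^-1` [set~ 0]) `|` (g @^-1` [set~ 0]).
have finD : finite_set D by rewrite finite_setU; split; exact: gr_finite.
rewrite !(@convEw D)//; last first.
- move=> x nz; have [fx0|] := pselect (f x = 0); last by left.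
  by right=> gx0; apply: nz; rewrite /preimage/= -[LHS]/(f x + g x) fx0 gx0 addr0.
- by move=> x; left.
- by move=> x; right.
by rewrite -big_split; apply: eq_bigr => x _; exact: mulrDl.
Qed.

Lemma gr_mulDr : right_distributive gr_mul +%R.
Proof. by move=> f g h; rewrite !(gr_mulC f) gr_mulDl. Qed.

Lemma gr_mul0 : left_zero 0 gr_mul.
Proof.
by move=> f; apply: (addrI (gr_mul 0 f)); rewrite -gr_mulDl !addr0.
Qed.

Lemma gr_mulr0 : right_zero 0 gr_mul.
Proof. by move=> f; rewrite gr_mulC gr_mul0. Qed.

Lemma gr_mul_delta a b k l :
  gr_mul (gr_delta a k) (gr_delta b l) = gr_delta (a * b) (k + l).
Proof.
apply: grP => z; rewrite gr_mulE (@convEw [set k])//; last first.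
  by move=> x /=; case: eqP.
rewrite fset_set1 big_seq_fset1 !gr_deltaE eqxx subr_eq [l + k]addrC.
by case: eqP => // _; rewrite mulr0.
Qed.

Lemma gr_mulA : associative gr_mul.
Proof.
move=> f g h; elim/gr_ind: f => [|f f' Hf Hf'|a k].
- by rewrite !gr_mul0.
- by rewrite !gr_mulDl Hf Hf'.
elim/gr_ind: g => [|g g' Hg Hg'|b l].
- by rewrite !(gr_mul0, gr_mulr0).
- by rewrite !(gr_mulDl, gr_mulDr) Hg Hg'.
elim/gr_ind: h => [|h h' Hh Hh'|c m].
- by rewrite !gr_mulr0.
- by rewrite !gr_mulDr Hh Hh'.
by rewrite !gr_mul_delta mulrA addrA.
Qed.

Lemma gr_mul1 : left_id (gr_delta 1 0) gr_mul.
Proof.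
move=> f; elim/gr_ind: f => [|f f' Hf Hf'|a k].
- by rewrite gr_mulr0.
- by rewrite gr_mulDr Hf Hf'.
by rewrite gr_mul_delta mul1r add0r.
Qed.

HB.instance Definition _ :=
  GRing.Zmodule_isComPzRing.Build group_ring gr_mulA gr_mulC gr_mul1 gr_mulDl.

Lemma gr1E : 1 = gr_delta 1 0 :> group_ring. Proof. by []. Qed.

Lemma grME f g z : (f * g) z = \sum_(x \in [set: G]) f x * g (z - x).
Proof. by []. Qed.

Lemma gr_deltaM a b k l :
  gr_delta a k * gr_delta b l = gr_delta (a * b) (k + l).
Proof. exact: gr_mul_delta. Qed.

End GroupRing.

Section GroupRingMap.
Variables (A : comPzRingType) (G H : zmodType) (phi : {additive G -> H}).
Implicit Types f g : group_ring A G.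

Let push (f : G -> A) : H -> A := fun y => \sum_(x \in phi @^-1` [set y]) f x.

Let pushEw (D : set G) (f : G -> A) y :
  finite_set D -> f @^-1` [set~ 0] `<=` D ->
  push f y = \sum_(x <- fset_set D | phi x == y) f x.
Proof.
move=> finD suppD; rewrite /push fsbig_mkcond [RHS]big_mkcond/= -fsbig_finite//.
transitivity (\sum_(x \in [set: G]) if phi x == y then f x else 0).
  apply: eq_fsbigr => x _; rewrite /patch.
  by congr (if _ then _ else _); apply/idP/eqP; rewrite inE.
apply/esym/fsbig_widen => // x [_ nDx] /=; case: eqP => // _.
by have [|/suppD] := pselect (f x = 0).
Qed.

Let push_subproof f : push f \in @finite_supp A H.
Proof.
apply/finite_suppP.
apply: (@sub_finite_set _ _ (phi @` (f @^-1` [set~ 0]))); last first.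
  by apply: finite_image; exact: gr_finite.
by move=> y /= /fsum_neq0[x <- fx]; exists x.
Qed.

Definition group_ring_map f : group_ring A H := GroupRing (push_subproof f).

Let mapE f y : group_ring_map f y = push f y. Proof. by []. Qed.

Lemma group_ring_mapE f y :
  group_ring_map f y = \sum_(x \in phi @^-1` [set y]) f x.
Proof. by []. Qed.

Lemma group_ring_map_delta a k :
  group_ring_map (gr_delta a k) = gr_delta a (phi k).
Proof.
apply: grP => y; rewrite mapE (@pushEw [set k])//; last first.
  by move=> x /=; case: eqP.
by rewrite fset_set1 big_mkcond big_seq_fset1 /= eqxx eq_sym.
Qed.

Let mapD : {morph group_ring_map : f g / f + g}.
Proof.
move=> f g; apply: grP => y; rewrite grDE !mapE.
pose D := (f @^-1` [set~ 0]) `|` (g @^-1` [set~ 0]).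
have finD : finite_set D by rewrite finite_setU; split; exact: gr_finite.
rewrite !(@pushEw D)//; last first.
- move=> x nz; have [fx0|] := pselect (f x = 0); last by left.
  by right=> gx0; apply: nz; rewrite /preimage/= -[LHS]/(f x + g x) fx0 gx0 addr0.
- by move=> x; left.
- by move=> x; right.
by rewrite -big_split/=.
Qed.

Let map_zmod_morphism : zmod_morphism group_ring_map.
Proof.
move=> f g; apply: (addIr (group_ring_map g)).
by rewrite -mapD !subrK.
Qed.

HB.instance Definition _ :=
  GRing.isZmodMorphism.Build (group_ring A G) (group_ring A H) group_ring_map
    map_zmod_morphism.

Let map_monoid_morphism : monoid_morphism group_ring_map.
Proof.
split=> [|f g]; first by rewrite !gr1E group_ring_map_delta raddf0.
elim/gr_ind: f => [|f f' Hf Hf'|a k].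
- by rewrite !(mul0r, raddf0).
- by rewrite !(mulrDl, raddfD)/= Hf Hf'.
elim/gr_ind: g => [|g g' Hg Hg'|b l].
- by rewrite !(mulr0, raddf0).
- by rewrite !(mulrDr, raddfD)/= Hg Hg'.
by rewrite gr_deltaM !group_ring_map_delta gr_deltaM raddfD.
Qed.

HB.instance Definition _ :=
  GRing.isMonoidMorphism.Build (group_ring A G) (group_ring A H) group_ring_map
    map_monoid_morphism.

End GroupRingMap.

(* Z_l is the limit of the rings Z/l^(n+1), n >= 0; the trivial level is left *)
(* out because 'Z_1 denotes Z/2 and not the zero ring.                        *)

Section PadicReduction.
Variables (l : nat) (l_pr : prime l).

Lemma padic_modulusE n : (Zp_trunc (l ^ n.+1)).+2 = (l ^ n.+1)%N.
Proof. by rewrite Zp_cast// -(exp1n n.+1) ltn_exp2r// prime_gt1. Qed.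

Definition padic_reduce (m n : nat) (le_mn : (m <= n)%N)
  (x : 'Z_(l ^ n.+1)) : 'Z_(l ^ m.+1) := inZp x.

Variables (m n : nat) (le_mn : (m <= n)%N).

Let dvd_mod : ((Zp_trunc (l ^ m.+1)).+2 %| (Zp_trunc (l ^ n.+1)).+2)%N.
Proof. by rewrite !padic_modulusE dvdn_exp2l. Qed.

Let padic_reduceD : {morph padic_reduce le_mn : x y / x + y}.
Proof. by move=> x y; apply: val_inj; rewrite /= modn_dvdm// modnDm. Qed.

Let padic_reduce_zmod_morphism : zmod_morphism (padic_reduce le_mn).
Proof.
by move=> x y; apply: (addIr (padic_reduce le_mn y)); rewrite -padic_reduceD !subrK.
Qed.

Let padic_reduce_monoid_morphism : monoid_morphism (padic_reduce le_mn).
Proof.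
split=> [|x y]; apply: val_inj => /=; first by rewrite modn_dvdm.
by rewrite modn_dvdm// modnMm.
Qed.

HB.instance Definition _ := GRing.isZmodMorphism.Build
  'Z_(l ^ n.+1) 'Z_(l ^ m.+1) (padic_reduce le_mn) padic_reduce_zmod_morphism.
HB.instance Definition _ := GRing.isMonoidMorphism.Build
  'Z_(l ^ n.+1) 'Z_(l ^ m.+1) (padic_reduce le_mn) padic_reduce_monoid_morphism.

Definition padic_reduction : {rmorphism 'Z_(l ^ n.+1) -> 'Z_(l ^ m.+1)} :=
  padic_reduce le_mn.

End PadicReduction.

Definition padic_int (l : nat) (l_pr : prime l) : Type :=
  @invlim nat (fun m n => is_true (m <= n)%N)
    (fun n => 'Z_(l ^ n.+1) : comPzRingType)
    (fun m n le_mn => padic_reduction l_pr le_mn).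

Definition padic_coord l (l_pr : prime l) (x : padic_int l_pr) (n : nat) :
  'Z_(l ^ n.+1) := invlim_val x n.
Coercion padic_coord : padic_int >-> Funclass.

Section PadicInt.
Variables (l : nat) (l_pr : prime l).
Local Notation Zl := (padic_int l_pr).
Implicit Types x y : Zl.

HB.instance Definition _ := GRing.ComPzRing.on Zl.

Lemma padicP x y : (forall n, x n = y n) -> x = y.
Proof. by move=> xy; apply/val_inj/dprodP. Qed.

Lemma padic_compat x m n : (m <= n)%N -> (x n %% l ^ m.+1)%N = x m.
Proof.
move=> le_mn; have /compatibleP/(_ m n le_mn) := invlim_valP x.
rewrite /padic_coord => <- /=.
by congr (_ %% _)%N; rewrite padic_modulusE.
Qed.

Let padic_oner_neq0 : 1 != 0 :> Zl.
Proof.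
apply/eqP => /(congr1 (fun x : Zl => x 0%N : 'Z_(l ^ 1))) /eqP.
by rewrite [_ == _]oner_eq0.
Qed.

HB.instance Definition _ := GRing.PzSemiRing_isNonZero.Build Zl padic_oner_neq0.

Definition padic_unit : {pred Zl} := fun x => `[< exists y, y * x = 1 >].
Definition padic_inv x : Zl :=
  if pselect (exists y, y * x = 1) is left ex then projT1 (cid ex) else x.

Let padic_mulVx : {in padic_unit, left_inverse 1 padic_inv *%R}.
Proof.
move=> x /asboolP ux; rewrite /padic_inv; case: pselect => // ex.
by case: (cid ex).
Qed.

Let padic_unitPl x y : y * x = 1 -> padic_unit x.
Proof. by move=> yx; apply/asboolP; exists y. Qed.

Let padic_inv_out : {in [predC padic_unit], padic_inv =1 id}.
Proof.
by move=> x /asboolP nux; rewrite /padic_inv; case: pselect.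
Qed.

HB.instance Definition _ := GRing.ComNzRing_hasMulInverse.Build Zl
  padic_mulVx padic_unitPl padic_inv_out.

Let padic_neq0 x : x != 0 -> exists n, forall m, (n <= m)%N ->
  (0 < x m)%N /\ (logn l (x m) <= n)%N.
Proof.
move=> x_neq0; have [n xn0] : exists n, x n <> 0.
  apply: contrapT => noN; move/eqP: x_neq0; apply; apply: padicP => n.
  by apply: contrapT => xn; apply: noN; exists n.
exists n => m le_nm; have xm := padic_compat x le_nm.
have ndvd : ~~ (l ^ n.+1 %| x m)%N.
  apply/negP => /eqP xm0; apply: xn0; apply: val_inj => /=.
  by rewrite -xm xm0.
have xm_gt0 : (0 < x m)%N by case: (x m : nat) ndvd; rewrite ?dvdn0.
by split=> //; rewrite leqNgt; apply: contra ndvd => ?; rewrite pfactor_dvdn.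
Qed.

Let padic_integral : GRing.integral_domain_axiom Zl.
Proof.
move=> x y xy0; apply/norP => -[/padic_neq0[a xa] /padic_neq0[b yb]].
pose n := (a + b).+1.
have [x_gt0 x_le] := xa n (leqW (leq_addr _ _)).
have [y_gt0 y_le] := yb n (leqW (leq_addl _ _)).
have : (l ^ n.+1 %| padic_coord x n * padic_coord y n)%N.
  have modE u : (u %% (Zp_trunc (l ^ n.+1)).+2)%N = 0%N -> (l ^ n.+1 %| u)%N.
    by rewrite (padic_modulusE l_pr) => /eqP.
  apply: modE.
  by have /= := congr1 (fun z : Zl => nat_of_ord (padic_coord z n)) xy0.
rewrite pfactor_dvdn ?muln_gt0 ?x_gt0// lognM// leqNgt => /negP; apply.
by rewrite ltnS; apply/leqW/leq_add.
Qed.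

HB.instance Definition _ :=
  GRing.ComUnitRing_isIntegral.Build Zl padic_integral.

End PadicInt.

Definition padic_field (l : nat) (l_pr : prime l) : fieldType :=
  {fraction (padic_int l_pr)}.

(* An algebraic closure of F is a closedFieldType K with an embedding iota of *)
(* F such that this holds.                                                    *)
Definition algebraic_extension (F K : fieldType) (iota : {rmorphism F -> K}) :=
  forall x : K, algebraicOver iota x.

Definition padic_embed (l : nat) (l_pr : prime l) (K : fieldType)
  (iota : {rmorphism padic_field l_pr -> K}) (z : padic_int l_pr) : K :=
  iota (FracField.tofrac z).

Section GaloisGroup.
Variables (F K : fieldType) (iota : {rmorphism F -> K}).

Record galois_aut := GaloisAut {
  gal_fun :> {rmorphism K -> K};
  gal_bij : bijective gal_fun;
  gal_fix : forall a : F, gal_fun (iota a) = iota a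
}.

Let id_bij : bijective (idfun : {rmorphism K -> K}).
Proof. by exists id. Qed.

Definition gal_id := GaloisAut id_bij (fun=> erefl).

Lemma gal_comp_subproof (s t : galois_aut) : bijective (s \o t).
Proof. by apply: bij_comp; exact: gal_bij. Qed.

Lemma gal_comp_fix (s t : galois_aut) a : (s \o t) (iota a) = iota a.
Proof. by rewrite /= !gal_fix. Qed.

Definition gal_comp (s t : galois_aut) : galois_aut :=
  @GaloisAut (s \o t : {rmorphism K -> K}) (gal_comp_subproof s t)
    (gal_comp_fix s t).

Lemma gal_inv_exists (s : galois_aut) :
  exists t : K -> K, cancel s t /\ cancel t s.
Proof. by have [t stK tsK] := gal_bij s; exists t. Qed.

Definition gal_inv_fun (s : galois_aut) : K -> K :=
  projT1 (cid (gal_inv_exists s)).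

Lemma gal_funK (s : galois_aut) : cancel s (gal_inv_fun s).
Proof. by rewrite /gal_inv_fun; case: cid => t []. Qed.

Lemma gal_inv_funK (s : galois_aut) : cancel (gal_inv_fun s) s.
Proof. by rewrite /gal_inv_fun; case: cid => t []. Qed.

HB.instance Definition _ (s : galois_aut) := GRing.isZmodMorphism.Build K K
  (gal_inv_fun s) (can2_zmod_morphism (gal_funK s) (gal_inv_funK s)).
HB.instance Definition _ (s : galois_aut) := GRing.isMonoidMorphism.Build K K
  (gal_inv_fun s) (can2_monoid_morphism (gal_funK s) (gal_inv_funK s)).

Lemma gal_inv_bij (s : galois_aut) : bijective (gal_inv_fun s).
Proof. by exists s; [exact: gal_inv_funK | exact: gal_funK]. Qed.

Lemma gal_inv_fix (s : galois_aut) a : gal_inv_fun s (iota a) = iota a.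
Proof. by rewrite -{1}(gal_fix s a) gal_funK. Qed.

Definition gal_inv (s : galois_aut) : galois_aut :=
  @GaloisAut (gal_inv_fun s : {rmorphism K -> K}) (gal_inv_bij s)
    (gal_inv_fix s).

End GaloisGroup.

(* Characters of G with values in the group of roots of unity of K, the       *)
(* latter being discrete.                                                     *)

Section Characters.
Variables (G : topologicalZmodType) (K : fieldType).

Record character := Character {
  char_fun :> G -> K;
  charD : forall x y, char_fun (x + y) = char_fun x * char_fun y;
  char_root_of_unity : forall x, exists2 n, (0 < n)%N & char_fun x ^+ n = 1;
  char_continuous : continuous (char_fun : G -> discrete_topology K)
}.

HB.instance Definition _ := gen_eqMixin character.
HB.instance Definition _ := gen_choiceMixin character.

Lemma charP (w1 w2 : character) : w1 =1 w2 -> w1 = w2.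
Proof.
case: w1 w2 => [f1 D1 u1 c1] [f2 D2 u2 c2] /= /funext e.
by case: _ / e in D2 u2 c2 *; congr Character; exact: Prop_irrelevance.
Qed.

End Characters.

Section CharacterOrbits.
Variables (G : topologicalZmodType) (F K : fieldType).
Variable iota : {rmorphism F -> K}.
Implicit Types (s : galois_aut iota) (w : character G K).

Lemma gal_actD s w x y : (s \o w) (x + y) = (s \o w) x * (s \o w) y.
Proof. by rewrite /= charD rmorphM. Qed.

Lemma gal_act_root_of_unity s w x :
  exists2 n, (0 < n)%N & (s \o w) x ^+ n = 1.
Proof.
have [n n_gt0 wn] := char_root_of_unity w x.
by exists n => //=; rewrite -rmorphXn wn rmorph1.
Qed.

Lemma gal_act_continuous s w :
  continuous (s \o w : G -> discrete_topology K).
Proof.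
move=> x U sU; apply: (@char_continuous G K w x (s @^-1` U)).
rewrite nbhs_principalE; apply/principal_filterP; exact: nbhs_singleton sU.
Qed.

Definition gal_act s w : character G K :=
  Character (gal_actD s w) (gal_act_root_of_unity s w) (@gal_act_continuous s w).

Definition same_orbit : rel (character G K) :=
  fun w1 w2 => `[< exists s, gal_act s w1 = w2 >].

Lemma same_orbit_equiv : equiv_class_of same_orbit.
Proof.
split=> [w|w1 w2|w2 w1 w3].
- by apply/asboolP; exists (gal_id iota); exact: charP.
- by apply/asboolP/asboolP => -[s <-]; exists (gal_inv s); apply: charP => x /=;
    rewrite gal_funK.
- move=> /asboolP[s <-] /asboolP[t <-]; apply/asboolP; exists (gal_comp t s).
  exact: charP.
Qed.

Canonical same_orbit_equiv_rel := EquivRelPack same_orbit_equiv.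

Definition char_orbit : Type := {eq_quot same_orbit}.

HB.instance Definition _ := EqQuotient.on char_orbit.
HB.instance Definition _ := Choice.on char_orbit.

(* Independent of the representative, by orbit_imageE below.                  *)
Definition orbit_image (c : char_orbit) : set K := range (repr c : character G K).

Lemma gal_act_range s w : range (gal_act s w) = range w.
Proof.
have sub (t : galois_aut iota) v : range (gal_act t v) `<=` range v.
  move=> _ [x _ <-] /=.
  have [n n_gt0 wn] := char_root_of_unity v x.
  have [m prim_m dvd_mn] := prim_order_exists n_gt0 wn.
  have : t (v x) ^+ m = 1 by rewrite -rmorphXn (prim_expr_order prim_m) rmorph1.
  move=> /(prim_rootP prim_m)[i ->]; exists (x *+ i) => //.
  have v0 : v 0 = 1.
    have [k k_gt0 vk] := char_root_of_unity v 0.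
    have v0_neq0 : v 0 != 0.
      by apply: contra_eq_neq vk => ->; rewrite expr0n gtn_eqF// eq_sym oner_eq0.
    by apply: (mulfI v0_neq0); rewrite -charD addr0 mulr1.
  elim: (i : nat) => [|j IHj]; first by rewrite mulr0n expr0.
  by rewrite mulrS charD IHj exprS.
apply/seteqP; split; first exact: sub.
have {1}-> : w = gal_act (gal_inv s) (gal_act s w).
  by apply: charP => x /=; rewrite gal_funK.
exact: sub.
Qed.

Lemma orbit_imageE w : orbit_image (\pi_char_orbit w) = range w.
Proof.
have /eqmodP/asboolP[s] : w = repr (\pi_char_orbit w) %[mod char_orbit].
  by rewrite reprK.
by rewrite /orbit_image => <-; exact: gal_act_range.
Qed.

End CharacterOrbits.

(* adjoin j S is the subring A[S] of K generated by S over the image of A     *)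
(* under j, i.e. the intersection of the subrings containing both.            *)

Section GeneratedSubring.
Variables (A : pzRingType) (K : fieldType) (j : A -> K).

Definition adjoin_set (S : set K) : set K :=
  smallest (fun B : set K => subring_closed (fun x => x \in B)) (range j `|` S).

Definition adjoin_pred (S : set K) : {pred K} := fun x => x \in adjoin_set S.

Lemma adjoin_subring_closed S : subring_closed (adjoin_pred S).
Proof.
have mem x : (x \in adjoin_pred S) <-> adjoin_set S x.
  by split; rewrite unfold_in inE.
split=> [|x y /mem Sx /mem Sy|x y /mem Sx /mem Sy]; apply/mem => B [BS SB].
- by case: (BS) => /set_mem.
- have Bx : x \in B by apply/mem_set; exact: Sx.
  have By : y \in B by apply/mem_set; exact: Sy.
  by case: (BS) => _ /(_ _ _ Bx By) /set_mem.
- have Bx : x \in B by apply/mem_set; exact: Sx.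
  have By : y \in B by apply/mem_set; exact: Sy.
  by case: (BS) => _ _ /(_ _ _ Bx By) /set_mem.
Qed.

HB.instance Definition _ S :=
  GRing.isSubringClosed.Build K (adjoin_pred S) (adjoin_subring_closed S).

Record adjoin (S : set K) := Adjoin {
  adjoin_val :> K;
  adjoin_valP : adjoin_val \in adjoin_pred S
}.

HB.instance Definition _ S := [isSub for @adjoin_val S].
HB.instance Definition _ S := [Choice of adjoin S by <:].
HB.instance Definition _ S := GRing.SubChoice_isSubComNzRing.Build
  K (adjoin_pred S) (adjoin S) (adjoin_subring_closed S).

End GeneratedSubring.

Definition mu (K : fieldType) (n : nat) : set K := [set z | z ^+ n = 1].
Arguments mu : clear implicits.

Record open_subgroup (G : topologicalZmodType) := OpenSubgroup {
  os_pred :> zmodClosed G;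
  os_open : open [set x | x \in os_pred]
}.

Definition os_quot (G : topologicalZmodType) (U : open_subgroup G) : zmodType :=
  Quotient.quot U.

(* The abelian group G is written additively; it is profinite (compact,       *)
(* Hausdorff and totally disconnected), and all its finite continuous         *)
(* quotients are p-groups.                                                    *)
Definition pro_p_group (p : nat) (G : topologicalZmodType) :=
  [/\ compact [set: G], hausdorff_space G, totally_disconnected [set: G] &
      forall U : open_subgroup G, exists k, ([set: os_quot U] #= `I_(p ^ k))%card].

Section QuotientMap.
Variable G : topologicalZmodType.

Definition os_quot_map (U V : open_subgroup G) (sVU : {subset V <= U})
  (x : os_quot V) : os_quot U := \pi_(Quotient.quot U) (repr x).

Variables (U V : open_subgroup G) (sVU : {subset V <= U}).

Lemma os_quot_map_pi (x : G) :
  os_quot_map sVU (\pi_(Quotient.quot V) x) = \pi_(Quotient.quot U) x.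
Proof.
apply/eqP; rewrite /os_quot_map -Quotient.idealrBE; apply: sVU.
by rewrite Quotient.idealrBE reprK.
Qed.

Let os_quot_map_zmod_morphism : zmod_morphism (os_quot_map sVU).
Proof.
move=> x y; rewrite -[x]reprK -[y]reprK.
by rewrite -raddfB !os_quot_map_pi raddfB.
Qed.

HB.instance Definition _ := GRing.isZmodMorphism.Build (os_quot V) (os_quot U)
  (os_quot_map sVU) os_quot_map_zmod_morphism.

End QuotientMap.

(* A[[G]], the limit of the group rings A[G/U] over the open subgroups U.     *)
Definition completed_group_ring (A : comPzRingType) (G : topologicalZmodType) :=
  @invlim (open_subgroup G) (fun U V => {subset V <= U})
    (fun U => group_ring A (os_quot U))
    (fun U V sVU => group_ring_map (os_quot_map sVU)).

HB.instance Definition _ A G := GRing.ComPzRing.on (@completed_group_ring A G).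

Definition ring_isomorphic (R S : pzRingType) :=
  exists f : {rmorphism R -> S}, bijective f.

(* Main.v *)
Require Import Defs.
From HB Require Import structures.
From mathcomp Require Import all_boot all_order all_algebra finmap.
From mathcomp Require Import cyclic separable.
From mathcomp Require Import all_classical topology tvs.

Set Implicit Arguments.
Unset Strict Implicit.
Unset Printing Implicit Defensive.

Import GRing.Theory.

Local Open Scope classical_set_scope.
Local Open Scope ring_scope.
Local Open Scope quotient_scope.

(** Let K be the algebraic closure Qlbar, with its group of automorphisms over Q_l.
    Each continuous character w of Gamma extends to a ring morphism from the
    completed group ring to K (char_eval), with values in Z_l[w(Gamma)], and
    conjugate characters give conjugate values (char_eval_gal). Evaluating at one
    representative of each orbit gives the first isomorphism (orbit_eval). It is
    bijective because this holds at each finite level, in the following sense.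

    For U open, Gamma / U is a finite group whose order p^k is invertible in Z_l and
    in K. Hence the Fourier transform on Gamma / U is injective
    (fourier_injective, which amounts to the existence of enough characters in K),
    and any family of values indexed by the characters trivial on U is the
    transform of a function f from Gamma / U to K given by the inversion formula
    (fourier_interpolation). A choice of an element of Z_l[w(Gamma)] for one w in
    each orbit is the same as a Galois-equivariant family indexed by all characters
    (orbit_valueE); for such a family f is Galois-invariant by uniqueness, and
    integral over Z_l as 1 / p^k is in Z_l. So its values are in Q_l by Galois
    theory (fixed_field), and then in Z_l, which is integrally closed
    (padic_integrally_closed). Thus no denominators appear and f lies in
    Z_l[Gamma / U]. By uniqueness again these elements are compatible as U varies.

    Galois theory of the infinite extension K / Q_l enters only through the fact
    that an element fixed by all automorphisms is in Q_l, which follows by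
    extending partial automorphisms with the lemma of Zorn (partial_aut_extends).

    For the second isomorphism, the image of a character is a finite group of
    roots of unity of p-power order, hence some mu_{p^n} with n unique
    (character_image, mu_inj), and the factors are grouped according to n. *)

(** * Extension of automorphisms and the fixed field *)

Section PartialAutomorphisms.
Variables (F : fieldType) (K : closedFieldType) (iota : {rmorphism F -> K}).

Definition diagonal (a : F) : K * K := (iota a, iota a).

Fact diagonal_zmod_morphism : zmod_morphism diagonal.
Proof. by move=> a b; rewrite /diagonal rmorphB. Qed.
Fact diagonal_monoid_morphism : monoid_morphism diagonal.
Proof. by split=> [|a b]; rewrite /diagonal (rmorph1, rmorphM). Qed.
HB.instance Definition _ := GRing.isZmodMorphism.Build F (K * K)%type diagonal
  diagonal_zmod_morphism.
HB.instance Definition _ := GRing.isMonoidMorphism.Build F (K * K)%type diagonal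
  diagonal_monoid_morphism.

(** The graph of a morphism from an intermediate ring of K over F to K, that is
    a subring of K * K which is the graph of a function. Graphs rather than
    functions, so that extension is inclusion and chains have unions. *)
Record partial_aut := PartialAut {
  pa_graph :> {pred K * K};
  pa_subring : subring_closed pa_graph;
  pa_diagonal : forall a, diagonal a \in pa_graph;
  pa_functional : forall u, u \in pa_graph -> u.1 = 0 -> u = 0
}.

HB.instance Definition _ (P : partial_aut) :=
  GRing.isSubringClosed.Build (K * K)%type (pa_graph P) (pa_subring P).

Record pa_ring (P : partial_aut) := PaRing {
  pa_val :> K * K;
  pa_valP : pa_val \in P
}.

HB.instance Definition _ P := [isSub for @pa_val P].
HB.instance Definition _ P := [Choice of pa_ring P by <:].
HB.instance Definition _ P := GRing.SubChoice_isSubComNzRing.Build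
  (K * K)%type (pa_graph P) (pa_ring P) (pa_subring P).

Definition pa_pair P : {rmorphism pa_ring P -> K * K} := val.
Definition pa_dom P : {rmorphism pa_ring P -> K} :=
  (fst : {rmorphism K * K -> K}) \o pa_pair P.
Definition pa_cod P : {rmorphism pa_ring P -> K} :=
  (snd : {rmorphism K * K -> K}) \o pa_pair P.

Definition pa_const P (a : F) : pa_ring P := PaRing (pa_diagonal P a).

Fact pa_const_zmod_morphism P : zmod_morphism (pa_const P).
Proof. by move=> a b; apply: val_inj; rewrite /= raddfB. Qed.
Fact pa_const_monoid_morphism P : monoid_morphism (pa_const P).
Proof. by split=> [|a b]; apply: val_inj; rewrite /= (rmorph1, rmorphM). Qed.
HB.instance Definition _ P := GRing.isZmodMorphism.Build F (pa_ring P)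
  (pa_const P) (pa_const_zmod_morphism P).
HB.instance Definition _ P := GRing.isMonoidMorphism.Build F (pa_ring P)
  (pa_const P) (pa_const_monoid_morphism P).

Lemma pa_dom_inj P : injective (pa_dom P).
Proof.
move=> u v uv; apply/subr0_eq/val_inj; apply: (pa_functional (pa_valP _)).
by rewrite -[LHS]/(pa_dom P (u - v)) rmorphB uv subrr.
Qed.

Lemma pa_ring_horner P (q : {poly pa_ring P}) x y :
  (map_poly (pa_pair P) q).[(x, y)] =
    ((map_poly (pa_dom P) q).[x], (map_poly (pa_cod P) q).[y]).
Proof.
rewrite [LHS]surjective_pairing; congr (_, _).
  by rewrite -[LHS](horner_map (fst : {rmorphism K * K -> K})) -map_poly_comp.
by rewrite -[LHS](horner_map (snd : {rmorphism K * K -> K})) -map_poly_comp.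
Qed.

Hypothesis iota_alg : algebraic_extension iota.

(** Inverses come for free by algebraicity: if u is a root of r over F with
    r(0) nonzero, then r - r(0) = X s and s(u) / - r(0) inverts u. In particular
    the domain and the image of a partial automorphism are fields. *)
Lemma pa_inv P (u : pa_ring P) : u != 0 -> exists v, v * u = 1.
Proof.
move=> u_neq0; have u1_neq0 : pa_dom P u != 0.
  by apply: contra_neq u_neq0 => u0; apply: (@pa_dom_inj P); rewrite u0 rmorph0.
have [q q_neq0 qu] := iota_alg (pa_dom P u).
(* Dividing out a power of X makes the constant term nonzero. *)
have [m [r /= /implyP/(_ q_neq0) r0 qE]] := multiplicity_XsubC q 0.
have ru : root (map_poly iota r) (pa_dom P u).
  move: qu; rewrite qE subr0 rmorphM rmorphXn /= map_polyX rootM => /orP[//|].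
  by rewrite /root hornerXn expf_eq0 (negPf u1_neq0) andbF.
have [s sE] : exists s, r - r.[0]%:P = s * ('X - 0%:P).
  by apply/factor_theorem; rewrite /root !hornerE subrr.
have dE : pa_dom P \o pa_const P =1 iota by [].
have ru0 : (map_poly (pa_const P) r).[u] = 0.
  apply: (@pa_dom_inj P); rewrite rmorph0 -horner_map -map_poly_comp.
  by rewrite (eq_map_poly dE); apply/eqP.
have su : (map_poly (pa_const P) s).[u] * u = - (pa_const P) r.[0].
  move/(congr1 (fun t => (map_poly (pa_const P) t).[u])): sE.
  rewrite rmorphB rmorphM rmorphB /= !map_polyC map_polyX.
  rewrite !(hornerD, hornerM, hornerN, hornerC, hornerX) ru0 raddf0.
  by rewrite subr0 sub0r => <-.
exists (- (pa_const P) (r.[0])^-1 * (map_poly (pa_const P) s).[u]).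
by rewrite -mulrA su mulrNN -rmorphM mulVf ?rmorph1.
Qed.

(** The coefficients of the minimal polynomial of x over the domain of P are taken
    in the graph, so that it can also be read over the image of P. *)
Definition pa_minpoly P x (m : {poly pa_ring P}) :=
  [/\ m \is monic, root (map_poly (pa_dom P) m) x &
      forall q, q != 0 -> root (map_poly (pa_dom P) q) x -> (size m <= size q)%N].

Lemma pa_minpoly_exists P x : exists m, @pa_minpoly P x m.
Proof.
pose Q n := `[< exists q : {poly pa_ring P},
  [/\ q != 0, root (map_poly (pa_dom P) q) x & size q = n] >].
have exQ : exists n, Q n.
  have [q q_neq0 qx] := iota_alg x.
  pose q' := map_poly (pa_const P) q.
  exists (size q'); apply/asboolP; exists q'; split=> //.
    by rewrite map_poly_eq0.
  by rewrite /q' -map_poly_comp.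
case: (ex_minnP exQ) => n /asboolP[q [q_neq0 qx <-]] min_q.
have [|v vq] := @pa_inv P (lead_coef q); first by rewrite lead_coef_eq0.
have v_neq0 : v *: q != 0.
  apply: contra_neq q_neq0 => vq0.
  by rewrite -[q]scale1r -vq mulrC -scalerA vq0 scaler0.
exists (v *: q); split.
- have szle := size_scale_leq v q.
  have : lead_coef (v *: q) = 1; last by move/eqP.
  rewrite -vq {1}/lead_coef coefZ; congr (_ * _); rewrite /lead_coef.
  congr (_`_(_)); congr predn; apply/eqP; rewrite eqn_leq szle/=.
  apply: min_q; apply/asboolP; exists (v *: q); split=> //.
  by rewrite map_polyZ /root hornerZ (eqP qx) mulr0.
- by rewrite map_polyZ /root hornerZ (eqP qx) mulr0.
- move=> r r_neq0 rx; apply: leq_trans (size_scale_leq _ _) _.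
  by apply: min_q; apply/asboolP; exists r.
Qed.

(** The pairs (q1(x), q2(y)), for q over the graph with projections q1 and q2,
    form a function: if q1(x) = 0 then m divides q, hence q2(y) = 0. *)
Lemma pa_extend P x y (m : {poly pa_ring P}) :
  pa_minpoly x m -> root (map_poly (pa_cod P) m) y ->
  exists2 P' : partial_aut, {subset P <= P'} & (x, y) \in P'.
Proof.
move=> [m_monic mx min_m] my.
pose G : {pred K * K} :=
  fun t => `[< exists q : {poly pa_ring P}, t = (map_poly (pa_pair P) q).[(x, y)] >].
have GE q : (map_poly (pa_pair P) q).[(x, y)] \in G by apply/asboolP; exists q.
have G_subring : subring_closed G.
  split=> [|_ _ /asboolP[q ->] /asboolP[r ->]|_ _ /asboolP[q ->] /asboolP[r ->]].
  - by have := GE 1; rewrite rmorph1 hornerC.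
  - by have := GE (q - r); rewrite rmorphB hornerD hornerN.
  - by have := GE (q * r); rewrite rmorphM hornerM.
have subG : {subset P <= G}.
  by move=> u Pu; have := GE (PaRing Pu)%:P; rewrite map_polyC hornerC.
have Gfun u : u \in G -> u.1 = 0 -> u = 0.
  move=> /asboolP[q ->]; rewrite pa_ring_horner => qx0.
  have {qx0} qx : (map_poly (pa_dom P) q).[x] = 0 by [].
  have qE := Pdiv.RingMonic.rdivp_eq m_monic q.
  have r0 : Pdiv.Ring.rmodp q m = 0.
    apply: contraTeq (Pdiv.Ring.ltn_rmodpN0 q (monic_neq0 m_monic)) => r_neq0.
    rewrite -leqNgt; apply: min_m => //; move: qx; rewrite {1}qE.
    by rewrite rmorphD rmorphM hornerD hornerM (eqP mx) mulr0 add0r => /eqP.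
  rewrite qx; congr (_, _).
  by rewrite qE r0 addr0 rmorphM hornerM (eqP my) mulr0.
exists (PartialAut G_subring (fun a => subG _ (pa_diagonal P a)) Gfun) => //.
by have := GE 'X; rewrite map_polyX hornerX.
Qed.

Lemma pa_maximal (P : partial_aut) : exists2 M : partial_aut, {subset P <= M} &
  forall M' : partial_aut, {subset M <= M'} -> {subset M' <= M}.
Proof.
(* The empty set is admitted since it is the union of the empty chain. *)
pose good (A : set (K * K)) := A = set0 \/
  exists2 Q : partial_aut, {subset P <= Q} & A = [set` Q].
have [|A [goodA maxA]] := @Zorn_bigcup _ good.
  move=> C goodC totC; have [C0|] := pselect (forall A, C A -> A = set0).
    by left; apply: bigcup0.
  move=> /existsNP[A0 /not_implyP[CA0 A0_neq0]]; right.
  have [//|[Q0 PQ0 A0E]] := goodC _ CA0.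
  pose G : {pred K * K} := fun u => `[< (\bigcup_(X in C) X) u >].
  have GP u : reflect ((\bigcup_(X in C) X) u) (u \in G) by exact: asboolP.
  have subG : {subset Q0 <= G}.
    by move=> u Qu; apply/GP; exists A0 => //; rewrite A0E.
  have key (A B : set (K * K)) u v : C A -> C B -> A `<=` B -> A u -> B v ->
      exists Q : partial_aut, [/\ u \in Q, v \in Q & C [set` Q]].
    move=> CA CB AB Au Bv; have [B0|[Q _ BE]] := goodC _ CB.
      by move: Bv; rewrite B0.
    by exists Q; move: (AB _ Au) Bv CB; rewrite BE.
  have chain u v : u \in G -> v \in G ->
      exists Q : partial_aut, [/\ u \in Q, v \in Q & C [set` Q]].
    move=> /GP[A CA Au] /GP[B CB Bv].
    have [AB|BA] := totC _ _ CA CB; first exact: (key A B).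
    by have [Q [Qv Qu CQ]] := key B A v u CB CA BA Bv Au; exists Q.
  have sub (Q : partial_aut) : C [set` Q] -> {subset Q <= G}.
    by move=> CQ u Qu; apply/GP; exists [set` Q].
  have G_subring : subring_closed G.
    split=> [|u v Gu Gv|u v Gu Gv].
    - by apply: subG; exact: rpred1.
    - by have [Q [Qu Qv CQ]] := chain u v Gu Gv; apply/(sub _ CQ)/rpredB.
    - by have [Q [Qu Qv CQ]] := chain u v Gu Gv; apply/(sub _ CQ)/rpredM.
  have Gfun u : u \in G -> u.1 = 0 -> u = 0.
    move=> Gu; have [Q [Qu _ _]] := chain u u Gu Gu; exact: pa_functional Qu.
  exists (PartialAut G_subring (fun a => subG _ (pa_diagonal Q0 a)) Gfun).
    by move=> u /PQ0/subG.
  by apply/seteqP; split=> u /= /GP.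
have [A0|[M PM AE]] := goodA.
  exfalso; apply: (maxA [set` P]); last by right; exists P.
  rewrite A0; split; first exact: sub0set.
  by move=> /(_ _ (pa_diagonal P 0)).
exists M => // M' MM'; apply: contrapT => nM'M; apply: (maxA [set` M']).
  by rewrite AE; split=> // M'M; apply: nM'M => u /M'M.
by right; exists M' => // u /PM/MM'.
Qed.

(** An F-endomorphism s of K permutes the roots of each q over F: as q splits in
    K, q = s(q) splits with roots the images of the roots of q. *)
Lemma algebraic_endo_surj (s : {rmorphism K -> K}) :
  (forall a, s (iota a) = iota a) -> forall y, exists x, s x = y.
Proof.
move=> s_fix y; have [q q_neq0 qy] := iota_alg y.
have [rs qE] := closed_field_poly_normal (map_poly iota q).
have sq : map_poly s (map_poly iota q) = map_poly iota q.
  by rewrite -map_poly_comp; apply: eq_map_poly => a /=; rewrite s_fix.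
move: qy; rewrite -sq qE linearZ rmorph_prod /=.
under eq_bigr => z _ do rewrite rmorphB /= map_polyX map_polyC.
rewrite -(big_map s xpredT (fun z => 'X - z%:P)) rootZ; last first.
  by rewrite fmorph_eq0 lead_coef_eq0 map_poly_eq0.
by rewrite root_prod_XsubC => /mapP[x _ ->]; exists x.
Qed.

(** A maximal partial automorphism is total, since K is algebraic over F and
    contains a root of the conjugate of each minimal polynomial. *)
Lemma partial_aut_extends (P : partial_aut) : exists s : galois_aut iota,
  forall u, u \in P -> s u.1 = u.2.
Proof.
have [M PM maxM] := pa_maximal P.
have M_total x : exists y, (x, y) \in M.
  have [m xm] := pa_minpoly_exists M x; have [m_monic mx _] := xm.
  have /closed_rootP[y my] : size (map_poly (pa_cod M) m) != 1.
    rewrite size_map_poly_id0 ?(monicP m_monic) ?rmorph1 ?oner_eq0//.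
    apply: contraTneq mx => m1.
    have -> : m = 1.
      have := monicP m_monic; rewrite /lead_coef m1 => m0.
      by rewrite [LHS]size1_polyC ?m1// m0.
    by rewrite rmorph1 (negPf (root1 _)).
  by have [M' /maxM M'M /M'M] := pa_extend xm my; exists y.
pose f x := projT1 (cid (M_total x)).
have fM x : (x, f x) \in M by rewrite /f; case: cid.
have fE u : u \in M -> f u.1 = u.2.
  move=> Mu; apply/subr0_eq.
  have /pa_functional : (u.1, f u.1) - u \in M by rewrite rpredB.
  by rewrite /= subrr => /(_ erefl) /(congr1 snd).
have fB : zmod_morphism f.
  by move=> x y; apply: (fE (_, _)); apply: (rpredB (fM x) (fM y)).
have fMon : monoid_morphism f.
  split=> [|x y]; first by apply: (fE (_, _)); exact: (@rpred1 _ M).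
  by apply: (fE (_, _)); apply: (rpredM (fM x) (fM y)).
pose fZ := GRing.isZmodMorphism.Build K K f fB.
pose fZM := GRing.isMonoidMorphism.Build K K f fMon.
pose s : {rmorphism K -> K} := HB.pack f fZ fZM.
have s_fix a : s (iota a) = iota a by exact: (fE _ (pa_diagonal M a)).
have s_bij : bijective s.
  have [g gK] := choice (algebraic_endo_surj s_fix).
  by exists g => // x; apply: (fmorph_inj s); rewrite gK.
by exists (GaloisAut s_bij s_fix) => u /PM/fE.
Qed.

Definition base_graph : {pred K * K} := fun u => `[< exists a, u = diagonal a >].

Lemma base_subring_closed : subring_closed base_graph.
Proof.
split=> [|_ _ /asboolP[a ->] /asboolP[b ->]|_ _ /asboolP[a ->] /asboolP[b ->]].
- by apply/asboolP; exists 1; rewrite rmorph1.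
- by apply/asboolP; exists (a - b); rewrite rmorphB.
- by apply/asboolP; exists (a * b); rewrite rmorphM.
Qed.

Lemma base_diagonal a : diagonal a \in base_graph.
Proof. by apply/asboolP; exists a. Qed.

Lemma base_functional u : u \in base_graph -> u.1 = 0 -> u = 0.
Proof.
move=> /asboolP[a ->] /= /eqP; rewrite fmorph_eq0 => /eqP ->.
exact: (rmorph0 diagonal).
Qed.

Definition pa_base := PartialAut base_subring_closed base_diagonal base_functional.

(** The automorphisms carry z to any root of its minimal polynomial m over F, so
    if they all fix z then m = (X - z)^d; the coefficient - d z of X^(d-1) lies
    in F, hence so does z as d is invertible. *)
Lemma fixed_field z : (forall n, n.+1%:R != 0 :> K) ->
  (forall s : galois_aut iota, s z = z) -> exists a, z = iota a.
Proof.
move=> K_char0 z_fixed.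
have [m zm] := pa_minpoly_exists pa_base z; have [m_monic mz _] := zm.
have base_cod : pa_cod pa_base =1 pa_dom pa_base.
  by move=> [u /= /asboolP[a ->]].
have [rs mE] := closed_field_poly_normal (map_poly (pa_dom pa_base) m).
have all_z y : y \in rs -> y = z.
  move=> rs_y; have [|P' _ zyP'] := @pa_extend pa_base z y m zm.
    rewrite (eq_map_poly base_cod) mE (monicP (monic_map _ m_monic)) scale1r.
    by rewrite root_prod_XsubC.
  have [s /(_ _ zyP') /= <-] := partial_aut_extends P'; exact: z_fixed.
have rs_neq0 : size rs != 0.
  move: mz; rewrite mE (monicP (monic_map _ m_monic)) scale1r root_prod_XsubC.
  by case: (rs).
have := coefPn_prod_XsubC rs_neq0.
move: mE; rewrite (monicP (monic_map _ m_monic)) scale1r => <-.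
rewrite coef_map.
have -> : \sum_(y <- rs) y = z *+ (size rs).
  rewrite (eq_big_seq (fun=> z)); last by move=> y /all_z.
  by rewrite big_const_seq count_predT iter_addr addr0.
case: (m`_(_)) => u /= /asboolP[a ->] /= az.
have sz_neq0 : (size rs)%:R != 0 :> K by case: (size rs) rs_neq0.
exists (- a / (size rs)%:R); rewrite rmorphM fmorphV rmorphN rmorph_nat az opprK.
by rewrite -mulr_natr mulfK.
Qed.

End PartialAutomorphisms.

(** * The ring of l-adic integers is a valuation ring *)

Section FractionField.
Variable R : idomainType.
Local Notation tofrac := (@FracField.tofrac R).

Lemma fractionP (z : {fraction R}) :
  exists a b, b != 0 /\ z * tofrac b = tofrac a.
Proof.
elim/quotW: z => x; exists \n_x, \d_x; split; first exact: denom_ratioP.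
unlock FracField.tofrac; rewrite -[LHS]FracField.pi_mul; apply/eqmodP.
rewrite /= FracField.equivfE /FracField.mulf.
by rewrite !numden_Ratio ?mulf_neq0 ?oner_eq0 ?denom_ratioP// !mulr1 mulrC.
Qed.

(** If z is not in R, then its inverse c is; multiplying an equation of degree
    n + 1 for z over R by c^n expresses z as a polynomial in c over R. *)
Lemma valuation_ring_integrally_closed :
  (forall a b : R, (exists c, b = c * a) \/ (exists c, a = c * b)) ->
  forall z, integralOver tofrac z -> exists a, z = tofrac a.
Proof.
move=> total z [q q_monic qz].
have [a [b [b_neq0 zE]]] := fractionP z.
have fb_neq0 : tofrac b != 0 by rewrite tofrac_eq0.
have [[c bE]|[c aE]] := total a b; last first.
  by exists c; apply: (mulIf fb_neq0); rewrite zE aE rmorphM.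
have zc : z * tofrac c = 1.
  have fa_neq0 : tofrac a != 0.
    by rewrite tofrac_eq0; apply: contra_neq b_neq0 => a0; rewrite bE a0 mulr0.
  by apply: (mulIf fa_neq0); rewrite mul1r -mulrA -rmorphM -bE.
have [n szq] : exists n, size q = n.+2.
  case szq: (size q) => [|[|n]]; last by exists n.
    by have := monic_neq0 q_monic; rewrite -size_poly_eq0 szq.
  have q1 : q = 1.
    have := monicP q_monic; rewrite /lead_coef szq => q0.
    by rewrite [LHS]size1_polyC ?szq// q0.
  by move: qz; rewrite q1 (rmorph1 (map_poly tofrac)) (negPf (root1 _)).
have szfq : size (map_poly tofrac q) = n.+2.
  by rewrite size_map_poly_id0 ?szq// tofrac_eq0 (monicP q_monic) oner_eq0.
exists (- \sum_(i < n.+1) q`_i * c ^+ (n - i)).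
have lead : q`_n.+1 = 1 by have := monicP q_monic; rewrite /lead_coef szq.
have coefE i : (map_poly tofrac q)`_i = tofrac q`_i by exact: coef_map.
move: qz; rewrite /root horner_coef szfq big_ord_recr/= !coefE lead tofrac1 mul1r.
rewrite addr_eq0 => /eqP/(congr1 (fun t => - t * tofrac c ^+ n)).
rewrite opprK exprS -mulrA -exprMn zc expr1n mulr1 => <-.
rewrite rmorphN rmorph_sum mulNr mulr_suml; congr (- _).
apply: eq_bigr => i _; rewrite coefE rmorphM rmorphXn -mulrA; congr (_ * _).
have le_in : (i <= n)%N := ltn_ord i.
rewrite -[X in _ * _ ^+ X = _](subnK le_in) exprD mulrCA -exprMn zc expr1n.
by rewrite mulr1.
Qed.

End FractionField.

Section PadicIntegers.
Variables (l : nat) (l_pr : prime l).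
Local Notation Zl := (padic_int l_pr).
Implicit Types x y : Zl.

Lemma padic_reductionE m n (le_mn : (m <= n)%N) (a : 'Z_(l ^ n.+1)) :
  padic_reduction l_pr le_mn a = (a %% l ^ m.+1)%N :> nat.
Proof. by rewrite /=; congr (_ %% _)%N; exact: padic_modulusE. Qed.

Lemma padic_mulE x y n : (x * y : Zl) n = (x n * y n %% l ^ n.+1)%N :> nat.
Proof. by rewrite /=; congr (_ %% _)%N; exact: padic_modulusE. Qed.

(** Units lift from Z/l to each Z/l^(n+1), and inverses are compatible with
    reduction by uniqueness. *)
Lemma padic_unitP x : (x 0%N != 0) -> exists y, y * x = 1.
Proof.
move=> x0; pose y : dprod (fun n => 'Z_(l ^ n.+1) : comPzRingType) :=
  fun n => (x n : 'Z_(l ^ n.+1))^-1.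
have l1 n : (1 < l ^ n.+1)%N by rewrite -(exp1n n.+1) ltn_exp2r// prime_gt1.
have xU n : (x n : 'Z_(l ^ n.+1)) \is a GRing.unit.
  rewrite -[x n]natr_Zp unitZpE// coprimeXl// prime_coprime//.
  apply: contra x0 => lx; apply/eqP/val_inj => /=.
  by rewrite -(padic_compat x (leq0n n)); apply/eqP.
have y_compat : y \in compatible (fun m n le_mn => padic_reduction l_pr le_mn).
  apply/compatibleP => m n le_mn; rewrite /y rmorphV ?xU//; congr _^-1.
  exact: (compatibleP _ _ (invlim_valP x)).
exists (InvLim y_compat); apply: padicP => n; exact: (mulVr (xU n)).
Qed.

Lemma padic_natE n k : (n%:R : Zl) k = n%:R :> 'Z_(l ^ k.+1).
Proof. by elim: n => // n IHn; rewrite -!natr1 -IHn. Qed.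

Lemma padic_char0 n : n.+1%:R != 0 :> Zl.
Proof.
apply/eqP => /(congr1 (fun x : Zl => nat_of_ord (x n.+1))).
rewrite padic_natE.
have ln : (n.+1 < l ^ n.+2)%N.
  apply: leq_trans (ltn_expl n.+1 (prime_gt1 l_pr)) _.
  by rewrite leq_exp2l ?prime_gt1.
by rewrite val_Zp_nat ?modn_small//; apply: leq_ltn_trans ln.
Qed.

(** The coordinate of level n of x / l is read off that of level n + 1 of x. *)
Lemma padic_div x : x 0%N = 0 -> exists y, x = l%:R * y.
Proof.
move=> x0; have l_gt0 := prime_gt0 l_pr.
have lx n : (l %| x n)%N.
  have := padic_compat x (leq0n n); rewrite x0 expn1 => /eqP; exact.
pose y : dprod (fun n => 'Z_(l ^ n.+1) : comPzRingType) :=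
  fun n => inZp (x n.+1 %/ l).
have yE n : y n = (x n.+1 %/ l)%N :> nat.
  rewrite /= (padic_modulusE l_pr n) modn_small// ltn_divLR// -expnSr.
  by rewrite -[X in (_ < X)%N](padic_modulusE l_pr n.+1) ltn_ord.
have y_compat : y \in compatible (fun m n le_mn => padic_reduction l_pr le_mn).
  apply/compatibleP => m n le_mn; apply: val_inj.
  rewrite [LHS]padic_reductionE -[RHS]/(y m : nat) !yE.
  rewrite -(padic_compat x (_ : m.+1 <= n.+1)%N)//.
  have := divn_eq (x n.+1) (l ^ m.+2).
  set q := (_ %/ l ^ _)%N; set r := (_ %% l ^ m.+2)%N => xE.
  have lr : (l %| r)%N.
    by have := lx n.+1; rewrite xE dvdn_addr// dvdn_mull// expnS dvdn_mulr.
  rewrite xE expnSr mulnA divnMDl// modnMDl modn_small//.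
  by rewrite ltn_divLR// -expnSr ltn_mod expn_gt0 l_gt0.
pose z : Zl := InvLim y_compat.
have zE n : z n = (x n.+1 %/ l)%N :> nat by exact: yE.
exists z; apply: padicP => n; apply: val_inj.
rewrite [RHS]padic_mulE padic_natE zE.
rewrite val_Zp_nat; last by rewrite -(exp1n n.+1) ltn_exp2r// prime_gt1.
by rewrite modnMml mulnC divnK// padic_compat.
Qed.

Lemma padic_val x : x != 0 ->
  exists n u, (exists v, v * u = 1) /\ x = l%:R ^+ n * u.
Proof.
move=> x_neq0; have [n] : exists n, x n <> 0.
  apply: contrapT => noN; move/eqP: x_neq0; apply; apply: padicP => n.
  by apply: contrapT => xn; apply: noN; exists n.
elim: n x {x_neq0} => [|n IHn] x xn.
  by exists 0%N, x; split; [apply: padic_unitP; apply/eqP | rewrite expr0 mul1r].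
have [x0|] := eqVneq (x 0%N) 0; last first.
  by exists 0%N, x; split; [exact: padic_unitP | rewrite expr0 mul1r].
have [y xE] := padic_div x0; have [|k [u [uU yE]]] := IHn y.
  move=> yn; apply: xn; apply: val_inj; rewrite xE.
  rewrite [LHS]padic_mulE padic_natE.
  have /eqP/dvdnP[q ->] : (y n.+1 %% l ^ n.+1)%N = 0%N.
    by rewrite padic_compat// yn.
  rewrite val_Zp_nat; last by rewrite -(exp1n n.+2) ltn_exp2r// prime_gt1.
  by rewrite modnMml mulnCA -expnS modnMl.
by exists k.+1, u; split=> //; rewrite xE yE exprS mulrA.
Qed.

Lemma padic_dvd_total x y : (exists z, y = z * x) \/ (exists z, x = z * y).
Proof.
have [->|x_neq0] := eqVneq x 0; first by right; exists 0; rewrite mul0r.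
have [->|y_neq0] := eqVneq y 0; first by left; exists 0; rewrite mul0r.
have [m [u [[u' u'u] ->]]] := padic_val x_neq0.
have [n [v [[v' v'v] ->]]] := padic_val y_neq0.
wlog le_mn : m n u u' u'u v v' v'v {x y x_neq0 y_neq0} / (m <= n)%N.
  move=> wl; have [mn|nm] := leqP m n; first exact: wl u'u _ _ v'v mn.
  by have [|] := wl _ _ _ _ v'v _ _ u'u (ltnW nm); [right | left].
left; exists (l%:R ^+ (n - m) * u' * v).
rewrite [RHS](AC (3 * 2) ((1 * 4) * 3 * (2 * 5)))/= u'u mulr1.
by rewrite -exprD subnK.
Qed.

Lemma padic_integrally_closed (z : padic_field l_pr) :
  integralOver (@FracField.tofrac Zl) z -> exists a : Zl, z = FracField.tofrac a.
Proof. exact: valuation_ring_integrally_closed padic_dvd_total z. Qed.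

Lemma padic_prime_unit p k : prime p -> l <> p ->
  exists y : Zl, y * (p ^ k)%:R = 1.
Proof.
move=> p_pr neq_lp; apply: padic_unitP; rewrite padic_natE.
have l1 : (1 < l ^ 1)%N by rewrite expn1 prime_gt1.
rewrite -(inj_eq val_inj) [val _]val_Zp_nat//= expn1.
apply/negP; rewrite -/(_ %| _)%N Euclid_dvdX// => /andP[+ _].
by rewrite dvdn_prime2// => /eqP.
Qed.

End PadicIntegers.

(** * Fourier analysis on finite abelian groups *)

Section FiniteFourier.
Variables (K : fieldType) (G : zmodType) (e : seq G).
Hypotheses (e_uniq : uniq e) (e_full : forall x, x \in e).
Hypothesis e_invertible : (size e)%:R != 0 :> K.
Implicit Types (chi : G -> K) (f h : G -> K) (x y g : G).

Lemma sum_translate (V : nmodType) g (h : G -> V) : \sum_(x <- e) h (x + g) = \sum_(x <- e) h x.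
Proof.
rewrite -(big_map (fun x => x + g) xpredT h); apply: perm_big.
apply: uniq_perm; rewrite ?map_inj_uniq//; first exact: addIr.
by move=> x; rewrite e_full; apply/mapP; exists (x - g); rewrite ?e_full ?subrK.
Qed.

(** Translating by g permutes G, so the sum of all its elements does not change
    when (size e) g is added to it. *)
Lemma mulrn_size g : g *+ size e = 0.
Proof.
apply: (addrI (\sum_(x <- e) x)); rewrite addr0 -[RHS](sum_translate g) big_split.
by rewrite /= big_const_seq count_predT iter_addr addr0.
Qed.

Definition is_char chi := chi 0 = 1 /\ forall x y, chi (x + y) = chi x * chi y.

Lemma is_charX chi g i : is_char chi -> chi (g *+ i) = chi g ^+ i.
Proof.
move=> [chi0 chiD]; elim: i => [|i IHi]; first by rewrite mulr0n expr0.
by rewrite mulrS exprS chiD IHi.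
Qed.

Lemma char_root1 chi g : is_char chi -> chi g ^+ size e = 1.
Proof. by move=> chi_char; rewrite -is_charX// mulrn_size; case: chi_char. Qed.

Lemma char_neq0 chi g : is_char chi -> chi g != 0.
Proof.
move=> [chi0 chiD]; apply/eqP => chig; have := chiD g (- g).
by rewrite subrr chi0 chig mul0r => /eqP; rewrite oner_eq0.
Qed.

Lemma char_opp chi g : is_char chi -> chi (- g) = (chi g)^-1.
Proof.
move=> chi_char; have [chi0 chiD] := chi_char.
by apply: (mulfI (char_neq0 g chi_char)); rewrite -chiD subrr chi0 mulfV ?char_neq0.
Qed.

(** Translating the variable by an element g that separates the characters
    multiplies the sum by chi1 g / chi2 g, which is not 1. *)
Lemma char_orthogonality chi1 chi2 : is_char chi1 -> is_char chi2 ->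
  (exists x, chi1 x != chi2 x) -> \sum_(x <- e) chi1 x * chi2 (- x) = 0.
Proof.
move=> c1 c2 [g neq_g]; have [_ D1] := c1; have [_ D2] := c2.
set S := \sum_(x <- e) _.
have : S * (chi1 g * chi2 (- g)) = S.
  rewrite -[RHS](sum_translate g) mulr_suml; apply: eq_bigr => x _.
  by rewrite D1 opprD D2 mulrACA.
move=> /eqP; rewrite -subr_eq0 -{2}[S]mulr1 -mulrBr mulf_eq0 => /orP[/eqP//|].
rewrite subr_eq0 char_opp// => /eqP eq1; case/eqP: neq_g.
by rewrite -[LHS](mulfVK (char_neq0 g c2)) eq1 mul1r.
Qed.

(** The inverse Fourier transform of v over the family D of characters takes the
    prescribed values, by orthogonality. *)
Lemma fourier_interpolation (T : eqType) (D : seq T) (ch : T -> G -> K)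
    (v : T -> K) :
  uniq D -> {in D, forall t, is_char (ch t)} ->
  {in D &, forall s t, s != t -> exists x, ch s x != ch t x} ->
  {in D, forall s, \sum_(x <- e)
    ((size e)%:R^-1 * \sum_(t <- D) v t * ch t (- x)) * ch s x = v s}.
Proof.
move=> D_uniq chD sepD s sD.
under eq_bigr do rewrite -mulrA mulr_suml.
rewrite -mulr_sumr exchange_big/= (bigD1_seq s)//=.
rewrite [X in _ + X]big_seq_cond [X in _ + X]big1 => [|t]; last first.
  move=> /andP[tD ts]; under eq_bigr => x _ do rewrite -mulrA [ch t _ * _]mulrC.
  have [x neq_st] : exists x, ch s x != ch t x by apply: sepD; rewrite // eq_sym.
  rewrite -mulr_sumr char_orthogonality ?mulr0//; first exact: chD.
    exact: chD.
  by exists x.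
rewrite addr0 (eq_bigr (fun=> v s)) => [|x _]; last first.
  rewrite -mulrA (char_opp x (chD s sD)) mulVf ?mulr1//.
  exact: char_neq0 (chD s sD).
by rewrite big_const_seq count_predT iter_addr addr0 -[v s *+ _]mulr_natl mulKf.
Qed.

End FiniteFourier.

Section RootsOfUnity.
Variables (K : closedFieldType) (n : nat).
Hypothesis n_neq0 : n%:R != 0 :> K.

Lemma unity_roots_enum : exists rs : seq K,
  [/\ uniq rs, size rs = n & forall z, (z \in rs) = (z ^+ n == 1)].
Proof.
have n_gt0 : (0 < n)%N by case: n n_neq0 => //; rewrite eqxx.
have [rs] := closed_field_poly_normal ('X^n - 1 : {poly K}).
rewrite (monicP (monicXnsubC 1 n_gt0)) scale1r => rsE; exists rs; split.
- rewrite -separable_prod_XsubC -rsE unlock derivB derivC subr0 derivXn -scaler_nat.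
  rewrite coprimepZr// coprimep_expr// coprimepX /root !hornerE expr0n.
  by rewrite gtn_eqF// sub0r oppr_eq0 oner_eq0.
- by apply: succn_inj; rewrite -(size_prod_XsubC rs id) -rsE size_XnsubC.
- by move=> z; rewrite -root_prod_XsubC -rsE rootE !hornerE subr_eq0.
Qed.

Lemma prim_root_exists : exists z : K, n.-primitive_root z.
Proof.
have [rs [rs_uniq rs_size rsE]] := unity_roots_enum.
have n_gt0 : (0 < n)%N by case: n n_neq0 => //; rewrite eqxx.
have /hasP[z _ z_prim] : has n.-primitive_root rs; last by exists z.
apply: has_prim_root; rewrite ?rs_size//.
by apply/allP => z; rewrite rsE unity_rootE.
Qed.

End RootsOfUnity.

Section FourierInjectivity.
Variables (K : closedFieldType) (G : zmodType) (e : seq G).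
Hypotheses (e_uniq : uniq e) (e_full : forall x, x \in e).
Hypothesis e_invertible : (size e)%:R != 0 :> K.
Local Notation n := (size e).

(** The functions with zero Fourier transform. They form a translation-invariant
    subspace, so if some were nonzero, one of them would be a common eigenvector
    of all translations. *)
Definition annihilated (h : G -> K) :=
  forall chi, is_char chi -> \sum_(x <- e) h x * chi x = 0.

Lemma annihilated_translate h g : annihilated h -> annihilated (fun x => h (x + g)).
Proof.
move=> h_ann chi chi_char; have [_ chiD] := chi_char.
have := h_ann chi chi_char; rewrite -(sum_translate e_uniq e_full g).
under eq_bigr => x _ do rewrite chiD mulrA.
rewrite -mulr_suml => /eqP; rewrite mulf_eq0 => /orP[/eqP//|].
by rewrite (negPf (char_neq0 _ chi_char)).
Qed.

(** The translation T by g satisfies T^n = 1, so h is, up to the factor n, the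
    sum over j < n of its projections h_j to the eigenspaces of T, and some h_j is
    nonzero; being a combination of translates of h, it is still annihilated and
    still an eigenvector of each translation of which h is one. *)
Lemma eigenvector_step h g : annihilated h -> (exists x, h x != 0) ->
  exists h', [/\ annihilated h', exists x, h' x != 0,
    exists c, forall x, h' (x + g) = c * h' x &
    forall g' c, (forall x, h (x + g') = c * h x) ->
      forall x, h' (x + g') = c * h' x].
Proof.
move=> h_ann [x0 hx0]; have [z z_prim] := prim_root_exists e_invertible.
pose hj (j : nat) x := \sum_(i < n) (z ^+ j) ^+ i * h (x + g *+ i).
have n_gt0 := prim_order_gt0 z_prim.
have z_neq0 : z != 0.
  apply: contra_eq_neq (prim_expr_order z_prim) => ->.
  by rewrite expr0n gtn_eqF// eq_sym oner_eq0.
have shift j x : z ^+ j * hj j (x + g) = hj j x.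
  rewrite /hj mulr_sumr.
  have [m mE] : exists m, n = m.+1 by case: n n_gt0 => // m; exists m.
  rewrite mE big_ord_recr [RHS]big_ord_recl /= addrC expr0 mulr0n addr0.
  congr (_ + _).
    rewrite mulrA -exprS -mE -addrA -mulrS -mE mulrn_size// addr0.
    by rewrite exprAC (prim_expr_order z_prim) expr1n.
  by apply: eq_bigr => i _; rewrite mulrA -exprS -addrA -mulrS.
have sum_hj x : \sum_(j < n) hj j x = n%:R * h x.
  rewrite exchange_big/=.
  rewrite (bigD1 (Ordinal n_gt0))//= [X in _ + X]big1 ?addr0 => [|i i_neq0].
    rewrite (eq_bigr (fun=> h x)) => [|j _]; last first.
      by rewrite expr0 mul1r.
    by rewrite sumr_const card_ord mulr_natl.
  rewrite -mulr_suml; under eq_bigr => j _ do rewrite exprAC.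
  have zi_neq1 : z ^+ i - 1 != 0.
    rewrite subr_eq0 -(prim_order_dvd z_prim) gtnNdvd ?ltn_ord//.
    by rewrite lt0n; apply: contra i_neq0 => /eqP i0; apply/eqP/val_inj.
  suff -> : \sum_(j < n) (z ^+ i) ^+ j = 0 by rewrite mul0r.
  apply: (mulfI zi_neq1); rewrite mulr0 -subrX1 exprAC (prim_expr_order z_prim).
  by rewrite expr1n subrr.
have [j hj_neq0] : exists j : 'I_n, hj j x0 != 0.
  apply: contrapT => no_j; move: hx0; have/eqP := sum_hj x0.
  rewrite big1 => [|j _]; first by rewrite eq_sym mulf_eq0 (negPf e_invertible)/= => ->.
  by apply: contrapT => /eqP hjx; apply: no_j; exists j.
exists (hj j); split; first 1 last.
- by exists x0.
- exists ((z ^+ j)^-1) => x; rewrite -(shift j x) mulKf// expf_neq0//.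
- move=> g' c hg' x; rewrite /hj mulr_sumr; apply: eq_bigr => i _.
  by rewrite addrAC hg' mulrCA.
move=> chi chi_char; under eq_bigr => x _ do rewrite mulr_suml.
rewrite exchange_big big1//= => i _; under eq_bigr => x _ do rewrite -mulrA.
by rewrite -mulr_sumr (annihilated_translate _ h_ann)// mulr0.
Qed.

(** A common eigenvector h of all translations is a multiple of a character, and
    h(x) chi(x) is then constant for the inverse chi of that character, so the sum
    of its values is n h(0), which is nonzero. *)
Lemma fourier_injective f : annihilated f -> forall x, f x = 0.
Proof.
move=> f_ann y; apply: contrapT => /eqP fy.
have [h [h_ann [x0 hx0] h_eigen]] : exists h, [/\ annihilated h, exists x, h x != 0 &
    forall g, g \in e -> exists c, forall x, h (x + g) = c * h x].
  elim: e => [|g s [h [h_ann h_neq0 h_eig]]].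
    by exists f; split=> [//||g]; [exists y | rewrite in_nil].
  have [h' [h'_ann h'_neq0 h'g h'_eig]] := eigenvector_step g h_ann h_neq0.
  exists h'; split=> // g'; rewrite inE => /predU1P[->//|/h_eig[c hc]].
  by exists c; apply: h'_eig.
have {}h_eigen g x : h (x + g) * h 0 = h x * h g.
  have [c hc] := h_eigen g (e_full g).
  by rewrite -[in RHS](add0r g) !hc mulrCA mulrA.
have h0 : h 0 != 0.
  apply: contra_neq hx0 => h0; apply/eqP.
  by rewrite -sqrf_eq0 expr2 -h_eigen h0 mulr0.
have chi_char : is_char (fun x => h (- x) / h 0).
  split=> [|x x']; first by rewrite oppr0 mulfV.
  apply: (mulIf h0); rewrite opprD mulfVK// [RHS]mulrAC mulfVK//.
  by rewrite -[LHS](mulfK h0) h_eigen mulrA.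
have := h_ann _ chi_char; rewrite (eq_bigr (fun=> h 0)) => [|x _]; last first.
  by rewrite mulrA -h_eigen subrr mulfK.
rewrite big_const_seq count_predT iter_addr addr0 -mulr_natl => /eqP.
by rewrite mulf_eq0 (negPf e_invertible) (negPf h0).
Qed.

End FourierInjectivity.

(** * Characters with open kernel *)

Section OpenKernels.
Variables (G : topologicalZmodType) (K : fieldType).
Implicit Types (w : character G K) (U V : open_subgroup G).

Lemma character0 w : w 0 = 1.
Proof.
have [k k_gt0 wk] := char_root_of_unity w 0.
have w0_neq0 : w 0 != 0.
  by apply: contra_eq_neq wk => ->; rewrite expr0n gtn_eqF// eq_sym oner_eq0.
by apply: (mulfI w0_neq0); rewrite -charD addr0 mulr1.
Qed.

Lemma characterMn w x n : w (x *+ n) = w x ^+ n.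
Proof.
elim: n => [|n IHn]; first by rewrite mulr0n expr0 character0.
by rewrite mulrS charD IHn exprS.
Qed.

Definition ker_pred w : {pred G} := fun x => w x == 1.

Lemma ker_zmod_closed w : zmod_closed (ker_pred w).
Proof.
split=> [|x y]; rewrite !unfold_in ?character0// => /eqP wx /eqP wy; apply/eqP.
by have := charD w (x - y) y; rewrite subrK wx wy mulr1 => <-.
Qed.

HB.instance Definition _ w :=
  GRing.isZmodClosed.Build G (ker_pred w) (ker_zmod_closed w).

Lemma ker_open w : open [set x | x \in ker_pred w].
Proof.
have -> : [set x | x \in ker_pred w] = (w : G -> discrete_topology K) @^-1` [set 1].
  by apply/seteqP; split=> x; rewrite /= unfold_in => /eqP.
apply: open_comp => [x _|]; first exact: char_continuous.
exact: discrete_open.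
Qed.

Definition char_ker w := @OpenSubgroup G (ker_pred w) (ker_open w).

Lemma char_kerE w x : (x \in char_ker w) = (w x == 1).
Proof. by []. Qed.

(** The character induced by w on the quotient by U; it does not depend on the
    chosen representatives when w is trivial on U. *)
Definition quot_char U w (x : os_quot U) : K := w (repr x).

Lemma quot_charE U w x : {subset U <= char_ker w} ->
  quot_char w (\pi_(Quotient.quot U) x) = w x.
Proof.
move=> U_ker; rewrite /quot_char; set y := repr _.
have : y - x \in U by rewrite Quotient.idealrBE reprK.
move/U_ker; rewrite char_kerE => /eqP wyx.
by rewrite -[y](subrK x) charD wyx mul1r.
Qed.

Lemma quot_char_is_char U w : {subset U <= char_ker w} -> is_char (@quot_char U w).
Proof.
move=> U_ker; split=> [|x y].
  by rewrite -(raddf0 \pi_(Quotient.quot U)) quot_charE ?character0.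
by rewrite -{1}[x]reprK -{1}[y]reprK -raddfD quot_charE// charD.
Qed.

(** A character of the quotient is locally constant when pulled back to G, hence
    continuous for the discrete topology. *)
Lemma lift_quot_char U (chi : os_quot U -> K) n : (0 < n)%N ->
  is_char chi -> (forall x, chi x ^+ n = 1) ->
  exists2 w, {subset U <= char_ker w} & quot_char (U := U) w = chi.
Proof.
move=> n_gt0 [chi0 chiD] chi_root; pose f (x : G) := chi (\pi_(Quotient.quot U) x).
have fD x y : f (x + y) = f x * f y by rewrite /f raddfD chiD.
have f_root x : exists2 n, (0 < n)%N & f x ^+ n = 1.
  by exists n => //; exact: chi_root.
have fU x : x \in U -> f x = 1.
  move=> Ux; rewrite /f -chi0; congr chi; apply/eqP.
  by rewrite -(raddf0 \pi_(Quotient.quot U)) -Quotient.idealrBE subr0.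
have f_cont : continuous (f : G -> discrete_topology K).
  move=> x A fxA; have Afx : A (f x) by exact: nbhs_singleton fxA.
  rewrite /nbhs/=.
  have : nbhs x ((fun y => y - x) @^-1` [set y | y \in U]).
    apply: open_nbhs_nbhs; split; last by rewrite /= subrr rpred0.
    apply: open_comp; last exact: os_open.
    move=> y _; apply: (@continuous_comp _ _ _ (fun y : G => (y, x))
      (fun z : G * G => z.1 - z.2)); last exact: sub_continuous.
    by apply: cvg_pair; [exact: cvg_id | exact: cvg_cst].
  apply: filterS => y /= Uyx; rewrite -[y](subrK x) fD fU// mul1r//.
exists (Character fD f_root f_cont).
  by move=> x /fU fx; rewrite char_kerE; apply/eqP.
by apply/funext => x; rewrite /quot_char /= /f reprK.
Qed.

End OpenKernels.

(** * Evaluation of group rings and finite quotients *)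

Section GroupRingEvaluation.
Variables (A : comPzRingType) (K : fieldType) (j : {rmorphism A -> K}).

Section OneGroup.
Variables (G : zmodType) (e : seq G) (chi : G -> K).
Hypotheses (e_uniq : uniq e) (e_full : forall x, x \in e).
Implicit Types f g : group_ring A G.

(** The linear extension of chi to the group ring, or equally the value at chi of
    the Fourier transform of f. *)
Definition gr_eval f := \sum_(x <- e) j (f x) * chi x.

Lemma gr_evalD : {morph gr_eval : f g / f + g}.
Proof.
move=> f g; rewrite /gr_eval -big_split; apply: eq_bigr => x _.
by rewrite grDE rmorphD mulrDl.
Qed.

Lemma gr_eval0 : gr_eval 0 = 0.
Proof. by apply: big1 => x _; rewrite gr0E rmorph0 mul0r. Qed.

Lemma gr_eval_zmod_morphism : zmod_morphism gr_eval.
Proof. by move=> f g; apply: (addIr (gr_eval g)); rewrite -gr_evalD !subrK. Qed.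

Lemma gr_eval_delta a k : gr_eval (gr_delta a k) = j a * chi k.
Proof.
rewrite /gr_eval (bigD1_seq k)//= eqxx big1 ?addr0// => x /negPf xk.
by rewrite xk rmorph0 mul0r.
Qed.

Hypothesis chi_char : is_char chi.

Lemma gr_eval_monoid_morphism : monoid_morphism gr_eval.
Proof.
have [chi0 chiD] := chi_char.
split=> [|f g]; first by rewrite gr1E gr_eval_delta rmorph1 chi0 mulr1.
elim/gr_ind: f => [|f f' Hf Hf'|a k].
- by rewrite mul0r gr_eval0 mul0r.
- by rewrite mulrDl !gr_evalD Hf Hf' mulrDl.
elim/gr_ind: g => [|g g' Hg Hg'|b m].
- by rewrite mulr0 gr_eval0 mulr0.
- by rewrite mulrDr !gr_evalD Hg Hg' mulrDr.
by rewrite gr_deltaM !gr_eval_delta chiD rmorphM mulrACA.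
Qed.

End OneGroup.

Lemma gr_eval_map (G H : zmodType) (e : seq G) (e' : seq H)
    (phi : {additive G -> H}) (chi : G -> K) (chi' : H -> K) :
  uniq e -> (forall x, x \in e) -> uniq e' -> (forall x, x \in e') ->
  (forall x, chi x = chi' (phi x)) ->
  forall f, gr_eval e' chi' (group_ring_map phi f) = gr_eval e chi f.
Proof.
move=> eu ef e'u e'f chiE; elim/gr_ind => [|f g Hf Hg|a k].
- by rewrite raddf0 !gr_eval0.
- by rewrite raddfD !gr_evalD Hf Hg.
by rewrite group_ring_map_delta !gr_eval_delta// chiE.
Qed.

End GroupRingEvaluation.

Section FiniteQuotients.
Variables (G : topologicalZmodType) (U : open_subgroup G).

(** Meaningful when the quotient is finite: fset_set is empty on infinite sets. *)
Definition quot_enum : seq (os_quot U) := fset_set [set: os_quot U].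

Lemma quot_enum_uniq : uniq quot_enum.
Proof. exact: fset_uniq. Qed.

Lemma quot_enum_size n : ([set: os_quot U] #= `I_n)%card -> size quot_enum = n.
Proof. exact: card_fset_set. Qed.

Lemma quot_enum_full n : ([set: os_quot U] #= `I_n)%card ->
  forall x, x \in quot_enum.
Proof.
move=> Un x; have Ufin : finite_set [set: os_quot U] by apply/finite_setP; exists n.
by rewrite [_ \in _]in_fset_set// inE.
Qed.

Lemma quot_char_inj (K : fieldType) (w w' : character G K) :
  {subset U <= char_ker w} -> {subset U <= char_ker w'} ->
  quot_char (U := U) w = quot_char w' -> w = w'.
Proof.
move=> Uw Uw' ww'; apply: charP => x.
by rewrite -(quot_charE x Uw) -(quot_charE x Uw') ww'.
Qed.

Variable K : closedFieldType.
Hypothesis U_full : forall x, x \in quot_enum.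
Hypothesis U_inv : (size quot_enum)%:R != 0 :> K.

Lemma lift_char (chi : os_quot U -> K) : is_char chi ->
  exists2 w : character G K, {subset U <= char_ker w} & quot_char (U := U) w = chi.
Proof.
move=> chi_char; apply: (@lift_quot_char _ _ _ _ (size quot_enum)) => //.
  by case: (size _) U_inv => //; rewrite eqxx.
by move=> x; apply: char_root1 => //; exact: quot_enum_uniq.
Qed.

(** A character of the quotient is a function from a finite set to the finite set
    of roots of unity of order dividing the order of the quotient. *)
Lemma finite_dual : exists D : seq (character G K),
  uniq D /\ forall w, w \in D <-> {subset U <= char_ker w}.
Proof.
pose A := [set w : character G K | {subset U <= char_ker w}].
suff finA : finite_set A.
  exists (fset_set A); split; first exact: fset_uniq.
  by move=> w; rewrite in_fset_set// inE.
have [rs [_ _ rsE]] := unity_roots_enum U_inv.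
have indexP x : (index x quot_enum < size quot_enum)%N by rewrite index_mem.
pose dec (t : {ffun 'I_(size quot_enum) -> seq_sub rs}) (x : os_quot U) : K :=
  val (t (Ordinal (indexP x))).
suff : finite_set ((fun w => quot_char (U := U) w) @` A).
  rewrite (eq_finite_set (inj_card_eq _))// => w w' /set_mem Aw /set_mem Aw'.
  exact: quot_char_inj.
apply: (@sub_finite_set _ _ (range dec)); last exact/finite_image/finite_finset.
move=> _ [w Uw <-].
have w_rs x : quot_char (U := U) w x \in rs.
  rewrite rsE; apply/eqP/char_root1 => //; first exact: quot_enum_uniq.
  exact: quot_char_is_char.
exists [ffun i : 'I_(size quot_enum) => SeqSub (w_rs (nth 0 quot_enum i))] => //.
by apply/funext => x; rewrite /dec ffunE /= nth_index.
Qed.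


End FiniteQuotients.

(** * Images of characters of pro-p groups *)

Section ImageIsMu.
Variables (p : nat) (p_pr : prime p) (K : closedFieldType).
Hypothesis K_char0 : forall n, n.+1%:R != 0 :> K.

(** The group mu (p ^ n) contains an element of order p^n. *)
Lemma mu_inj m n : mu K (p ^ m) = mu K (p ^ n) -> m = n.
Proof.
wlog suff dvd : m n / mu K (p ^ m) = mu K (p ^ n) -> (p ^ m %| p ^ n)%N.
  move=> mn; apply: (expnI (prime_gt1 p_pr)); apply/eqP.
  by rewrite eqn_dvd !dvd.
move=> mn; have [|z z_prim] := @prim_root_exists K (p ^ m).
  have : (0 < p ^ m)%N by rewrite expn_gt0 prime_gt0.
  by case: (p ^ m)%N => // k _.
have : mu K (p ^ m) z by exact: prim_expr_order.
by rewrite mn => /eqP; rewrite -(prim_order_dvd z_prim).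
Qed.

Lemma prim_root_pfactor (z : K) n :
  z ^+ (p ^ n.+1) = 1 -> z ^+ (p ^ n) != 1 -> (p ^ n.+1).-primitive_root z.
Proof.
move=> zn1 zn; have [|d d_prim /(dvdn_pfactor _ _ p_pr)] := prim_order_exists _ zn1.
  by rewrite expn_gt0 prime_gt0.
move=> [m le_m dE]; have [m_n|] := leqP m n.
  by case/eqP: zn; apply/eqP; rewrite -(prim_order_dvd d_prim) dE dvdn_exp2l.
by move=> lt_nm; have <- : m = n.+1 by [apply/eqP; rewrite eqn_leq le_m]; rewrite -dE.
Qed.

Variable G : topologicalZmodType.
Hypothesis G_pro_p : pro_p_group p G.

Lemma pro_p_quot (U : open_subgroup G) :
  (forall x, x \in @quot_enum G U) /\ exists k, size (@quot_enum G U) = (p ^ k)%N.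
Proof.
have [_ _ _ /(_ U)[k Uk]] := G_pro_p; split; first exact: quot_enum_full Uk.
by exists k; exact: quot_enum_size.
Qed.

(** All values are roots of unity of order dividing p^k. If n is the least exponent
    such that p^n kills them all, some value has order exactly p^n, and its powers
    are all the roots of unity of that order. *)
Lemma character_image (w : character G K) : exists n, range w = mu K (p ^ n).
Proof.
have [U_full [k U_size]] := pro_p_quot (char_ker w).
have wk x : w x ^+ (p ^ k) = 1.
  rewrite -(quot_charE (U := char_ker w) x)// -U_size.
  by apply: char_root1 => //; [exact: quot_enum_uniq | exact: quot_char_is_char].
pose P n := `[< forall x, w x ^+ (p ^ n) = 1 >].
have exP : exists n, P n by exists k; apply/asboolP.
case: (ex_minnP exP) => -[|n] /asboolP wn min_n.
  exists 0%N; apply/seteqP; split=> [_ [x _ <-]|z].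
    exact: wn.
  by rewrite /mu/= expn0 expr1 => ->; exists 0; rewrite ?character0.
have [x wx] : exists x, w x ^+ (p ^ n) != 1.
  apply: contrapT => nox; have /min_n : P n; last by rewrite ltnn.
  by apply/asboolP => x; apply: contrapT => /eqP wx; apply: nox; exists x.
exists n.+1; apply/seteqP; split=> [_ [y _ <-]|z]; first exact: wn.
move=> /(prim_rootP (prim_root_pfactor (wn x) wx))[i ->].
by exists (x *+ i); rewrite ?characterMn.
Qed.

End ImageIsMu.


(** * Products of adjoined rings *)

Lemma ring_isomorphic_of (R S : pzRingType) (f : R -> S) :
  zmod_morphism f -> monoid_morphism f -> bijective f -> ring_isomorphic R S.
Proof.
move=> fB fM f_bij; pose fZ := GRing.isZmodMorphism.Build R S f fB.
pose fZM := GRing.isMonoidMorphism.Build R S f fM.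
pose g : {rmorphism R -> S} := HB.pack f fZ fZM.
by exists g; exact: f_bij.
Qed.

Section AdjoinCast.
Variables (A : pzRingType) (K : fieldType) (j : A -> K).

Lemma adjoin_cast_subproof (S T : set K) (eST : S = T) (x : adjoin j S) :
  val x \in adjoin_pred j T.
Proof. by case: _ / eST; exact: valP. Qed.

Definition adjoin_cast S T eST x : adjoin j T :=
  Adjoin (@adjoin_cast_subproof S T eST x).

End AdjoinCast.

(** Grouping the factors of a product according to the value n of the index: the
    sets S i are only propositionally equal to T n, so each factor is
    transported along that equality. *)
Lemma dprod_fibre_isomorphic (A : pzRingType) (K : fieldType) (j : A -> K)
    (I J : Type) (S : I -> set K) (T : J -> set K) :
  (forall i, exists n, S i = T n) -> injective T ->
  ring_isomorphic (dprod (fun i => adjoin j (S i)))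
    (dprod (fun n => dprod (fun i : {i | S i = T n} => adjoin j (T n)))).
Proof.
move=> exT T_inj.
pose F (f : dprod (fun i => adjoin j (S i))) :
    dprod (fun n => dprod (fun i : {i | S i = T n} => adjoin j (T n))) :=
  fun n i => adjoin_cast (proj2_sig i) (f (proj1_sig i)).
apply: (@ring_isomorphic_of _ _ F).
- by move=> f g; apply: dprodP => n; apply: dprodP => i; apply: val_inj.
- by split=> [|f g]; apply: dprodP => n; apply: dprodP => i; apply: val_inj.
pose n_of i := projT1 (cid (exT i)).
have nE i : S i = T (n_of i) by rewrite /n_of; case: cid.
pose F' (h : dprod (fun n => dprod (fun i : {i | S i = T n} => adjoin j (T n)))) :
    dprod (fun i => adjoin j (S i)) :=
  fun i => adjoin_cast (esym (nE i)) (h (n_of i) (exist _ i (nE i))).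
exists F'.
  by move=> f; apply: dprodP => i; apply: val_inj.
move=> h; apply: dprodP => n; apply: dprodP => -[i ei]; apply: val_inj => /=.
have en : n_of i = n by apply: T_inj; rewrite -nE.
move: (nE i); rewrite en => ei'; congr (val (h n (exist _ i _))).
exact: Prop_irrelevance.
Qed.

Section AdjoinLemmas.
Variables (A : comNzRingType) (K : fieldType) (j : {rmorphism A -> K}) (S : set K).

Lemma adjoin_base a : j a \in adjoin_pred j S.
Proof. by rewrite unfold_in inE => B [_]; apply; left; exists a. Qed.

Lemma adjoin_generator z : S z -> z \in adjoin_pred j S.
Proof. by move=> Sz; rewrite unfold_in inE => B [_]; apply; right. Qed.

Lemma adjoin_least (B : set K) z : subring_closed (fun x => x \in B) ->
  (forall a, B (j a)) -> S `<=` B -> z \in adjoin_pred j S -> B z.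
Proof.
move=> B_ring B_base SB; rewrite unfold_in inE => zS; apply: zS; split=> //.
by move=> u [[a _ <-]|/SB].
Qed.

Lemma adjoin_integral z : (forall u, S u -> exists2 n, (0 < n)%N & u ^+ n = 1) ->
  z \in adjoin_pred j S -> integralOver j z.
Proof.
move=> S_root; apply: (@adjoin_least [set z | integralOver j z]).
- split=> [|u v|u v]; rewrite !inE.
  + by have := integral_id j 1; rewrite rmorph1.
  + exact: integral_sub.
  + exact: integral_mul.
- exact: integral_id.
- move=> u /S_root[n n_gt0 un]; exists ('X^n - 1); first exact: monicXnsubC.
  by rewrite rmorphB /= map_polyXn rmorph1 rootE !hornerE un subrr.
Qed.

Lemma adjoin_morph_ext (s t : {rmorphism K -> K}) z :
  (forall a, s (j a) = t (j a)) -> (forall u, S u -> s u = t u) ->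
  z \in adjoin_pred j S -> s z = t z.
Proof.
move=> st_base stS; apply: (@adjoin_least [set z | s z = t z]) => //.
split=> [|u v|u v]; rewrite !inE /=; first by rewrite !rmorph1.
- by rewrite !rmorphB => -> ->.
- by rewrite !rmorphM => -> ->.
Qed.

End AdjoinLemmas.


(** * The completed group ring and the orbits of characters *)

Section MainIsomorphism.
Variables (l p : nat) (l_pr : prime l) (p_pr : prime p) (neq_lp : l <> p).
Variables (Gamma : topologicalZmodType) (Gamma_pro_p : pro_p_group p Gamma).
Variables (Qlbar : closedFieldType) (iota : {rmorphism padic_field l_pr -> Qlbar}).
Hypothesis iota_alg : algebraic_extension iota.

Local Notation Zl := (padic_int l_pr).
Local Notation Lambda := (completed_group_ring Zl Gamma).
Local Notation orbit := (char_orbit Gamma iota).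
Implicit Types (w : character Gamma Qlbar) (U V : open_subgroup Gamma).

Fact embed_zmod_morphism : zmod_morphism (padic_embed iota).
Proof. by move=> a b; rewrite /padic_embed !rmorphB. Qed.
Fact embed_monoid_morphism : monoid_morphism (padic_embed iota).
Proof.
by split=> [|a b]; rewrite /padic_embed; [rewrite !rmorph1 | rewrite !rmorphM].
Qed.
HB.instance Definition _ := GRing.isZmodMorphism.Build Zl Qlbar
  (padic_embed iota) embed_zmod_morphism.
HB.instance Definition _ := GRing.isMonoidMorphism.Build Zl Qlbar
  (padic_embed iota) embed_monoid_morphism.

Let j : {rmorphism Zl -> Qlbar} := padic_embed iota.

Lemma embed_inj : injective j.
Proof.
move=> a b /(fmorph_inj iota)/eqP; rewrite -subr_eq0 -rmorphB tofrac_eq0 subr_eq0.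
by move/eqP.
Qed.

Lemma gal_embed (s : galois_aut iota) a : s (j a) = j a.
Proof. exact: gal_fix. Qed.

Lemma Qlbar_char0 n : n.+1%:R != 0 :> Qlbar.
Proof.
rewrite -(rmorph_nat j) -(rmorph0 j) (inj_eq embed_inj).
exact: padic_char0.
Qed.

Lemma quot_size_inv U : (size (@quot_enum Gamma U))%:R != 0 :> Qlbar.
Proof.
have [_ [k ->]] := pro_p_quot Gamma_pro_p U.
have : (0 < p ^ k)%N by rewrite expn_gt0 prime_gt0.
by case: (p ^ k)%N => // m _; exact: Qlbar_char0.
Qed.

Lemma quot_full U x : x \in @quot_enum Gamma U.
Proof. by have [] := pro_p_quot Gamma_pro_p U. Qed.

Definition quot_eval U w : group_ring Zl (os_quot U) -> Qlbar :=
  gr_eval j (@quot_enum Gamma U) (quot_char w).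

(** Injectivity of the Fourier transform at the level U. *)
Lemma quot_eval_inj U (f g : group_ring Zl (os_quot U)) :
  (forall w, {subset U <= char_ker w} -> quot_eval w f = quot_eval w g) -> f = g.
Proof.
move=> fg; apply: grP => x; apply/embed_inj/subr0_eq.
move: x; apply: (@fourier_injective Qlbar _ (@quot_enum Gamma U)).
- exact: quot_enum_uniq.
- exact: quot_full.
- exact: quot_size_inv.
move=> chi chi_char.
have [w Uw <-] := lift_char (@quot_full U) (@quot_size_inv U) chi_char.
under eq_bigr => x _ do rewrite mulrBl.
by rewrite sumrB; apply/eqP; rewrite subr_eq0; apply/eqP; exact: fg.
Qed.

Lemma quot_eval_map U V (sVU : {subset V <= U}) w (f : group_ring Zl (os_quot V)) :
  {subset U <= char_ker w} ->
  quot_eval w (group_ring_map (os_quot_map sVU) f) = quot_eval w f.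
Proof.
move=> Uw; apply: gr_eval_map; try exact: quot_enum_uniq; try exact: quot_full.
by move=> x; rewrite [RHS](quot_charE (repr x) Uw).
Qed.

(** The ring morphism from the completed group ring that extends w, computed at the
    finite level where w first makes sense; by char_evalE any finer level gives
    the same value. *)
Definition char_eval w (x : Lambda) : Qlbar :=
  quot_eval w (invlim_val x (char_ker w)).

Lemma char_evalE U w (x : Lambda) : {subset U <= char_ker w} ->
  quot_eval w (invlim_val x U) = char_eval w x.
Proof.
move=> Uw; rewrite /char_eval.
have /compatibleP/(_ _ _ Uw) <- := invlim_valP x.
by rewrite quot_eval_map.
Qed.

Lemma gal_char_ker (s : galois_aut iota) w :
  {subset char_ker w <= char_ker (gal_act s w)}.
Proof. by move=> x; rewrite !char_kerE /= => /eqP ->; rewrite rmorph1. Qed.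

Lemma quot_eval_gal U (s : galois_aut iota) w f :
  quot_eval (U := U) (gal_act s w) f = s (quot_eval w f).
Proof.
rewrite /quot_eval /gr_eval rmorph_sum; apply: eq_bigr => x _.
by rewrite rmorphM gal_embed.
Qed.

Lemma char_eval_gal (s : galois_aut iota) w x :
  char_eval (gal_act s w) x = s (char_eval w x).
Proof. by rewrite -(char_evalE x (@gal_char_ker s w)) quot_eval_gal. Qed.

Lemma char_eval_adjoin w x : char_eval w x \in adjoin_pred j (range w).
Proof.
apply: rpred_sum => y _; apply: rpredM; first exact: adjoin_base.
by apply: adjoin_generator; exists (repr y).
Qed.

Lemma orbitP w : exists s : galois_aut iota, gal_act s (repr (\pi_orbit w)) = w.
Proof.
have /eqmodP/asboolP[s sE] : repr (\pi_orbit w) = w %[mod orbit] by rewrite reprK.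
by exists s.
Qed.

Definition orbit_eval (x : Lambda) : dprod (fun c : orbit =>
    adjoin (padic_embed iota) (orbit_image c)) :=
  fun c => Adjoin (char_eval_adjoin (repr c) x).

Lemma char_eval_zmod_morphism w : zmod_morphism (char_eval w).
Proof. move=> x y; exact: (gr_eval_zmod_morphism j). Qed.

Lemma char_eval_monoid_morphism w : monoid_morphism (char_eval w).
Proof.
have [] := gr_eval_monoid_morphism j (@quot_enum_uniq Gamma (char_ker w))
  (@quot_full (char_ker w)) (@quot_char_is_char _ _ _ w (fun _ => id)).
by move=> ev1 evM; split=> [|x y]; [exact: ev1 | exact: evM].
Qed.

(** Each character is conjugate to the representative of its orbit, so vanishing at
    the representatives forces vanishing at all characters. *)
Lemma orbit_eval_inj : injective orbit_eval.
Proof.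
move=> x y xy; apply/val_inj/dprodP => U; apply: quot_eval_inj => w Uw.
rewrite !char_evalE//; have [s <-] := orbitP w; rewrite !char_eval_gal.
by congr (s _); have := congr1 (fun f => val (f (\pi_orbit w))) xy.
Qed.

Section Preimage.
Variable y : dprod (fun c : orbit => adjoin (padic_embed iota) (orbit_image c)).

(** The unique extension of y to a Galois-equivariant family indexed by all
    characters; it is well defined because two automorphisms that agree on the
    values of a character w agree on the ring generated by them. *)
Definition orbit_value w : Qlbar :=
  (projT1 (cid (orbitP w)) : galois_aut iota) (val (y (\pi_orbit w))).

Lemma orbit_valueE (s : galois_aut iota) c w : gal_act s (repr c) = w ->
  orbit_value w = s (val (y c)).
Proof.
move=> sE; have cE : \pi_orbit w = c.
  rewrite -[c in RHS]reprK; apply/eqmodP/asboolP.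
  by exists (gal_inv s); rewrite -sE; apply: charP => x /=; rewrite gal_funK.
case: _ / cE in sE *; rewrite /orbit_value; case: cid => t /= tE.
apply: (adjoin_morph_ext (j := j)) (valP (y (\pi_orbit w))) => [a|].
  by rewrite !gal_embed.
move=> _ [x _ <-]; have := congr1 (fun v : character _ _ => v x) tE.
by have := congr1 (fun v : character _ _ => v x) sE => /= -> ->.
Qed.

Lemma orbit_value_gal (s : galois_aut iota) w :
  orbit_value (gal_act s w) = s (orbit_value w).
Proof.
have [t tE] := orbitP w; rewrite (orbit_valueE tE).
have stE : gal_act (gal_comp s t) (repr (\pi_orbit w)) = gal_act s w.
  by rewrite -[in RHS]tE; apply: charP.
exact: orbit_valueE stE.
Qed.

Lemma orbit_value_repr c : orbit_value (repr c) = val (y c).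
Proof. by rewrite (orbit_valueE (s := gal_id iota) (c := c))//; exact: charP. Qed.

Lemma orbit_value_integral w : integralOver j (orbit_value w).
Proof.
have [s sE] := orbitP w; rewrite (orbit_valueE sE).
have [q q_monic qy] : integralOver j (val (y (\pi_orbit w))).
  apply: adjoin_integral (valP _) => _ [x _ <-]; exact: char_root_of_unity.
exists q => //; rewrite -(fmorph_root s) -map_poly_comp in qy.
by rewrite (eq_map_poly (gal_embed s)) in qy.
Qed.

(** The conjugate of f by s has the same Fourier transform as f, since the
    prescribed values are equivariant. *)
Lemma interpolation_gal U (s : galois_aut iota) (f : os_quot U -> Qlbar) :
  (forall w, {subset U <= char_ker w} ->
    \sum_(x <- @quot_enum Gamma U) f x * quot_char w x = orbit_value w) ->
  forall x, s (f x) = f x.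
Proof.
move=> f_interp x; apply/subr0_eq; move: x.
apply: (@fourier_injective Qlbar _ (@quot_enum Gamma U)).
- exact: quot_enum_uniq.
- exact: quot_full.
- exact: quot_size_inv.
move=> chi chi_char.
have [w Uw <-] := lift_char (@quot_full U) (@quot_size_inv U) chi_char.
under eq_bigr => x _ do rewrite mulrBl.
rewrite sumrB f_interp//; apply/eqP; rewrite subr_eq0; apply/eqP.
pose w' := gal_act (gal_inv s) w.
have w'E : gal_act s w' = w by apply: charP => x /=; rewrite gal_inv_funK.
have Uw' : {subset U <= char_ker w'}.
  by move=> x /Uw; exact: gal_char_ker.
rewrite -{2}w'E orbit_value_gal -f_interp// rmorph_sum; apply: eq_bigr => x _.
by rewrite rmorphM -{1}w'E.
Qed.

Lemma integral_fixed z : integralOver j z -> (forall s : galois_aut iota, s z = z) ->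
  exists a : Zl, z = j a.
Proof.
move=> [q q_monic qz] /(fixed_field iota_alg Qlbar_char0)[b zE].
have [|a bE] := @padic_integrally_closed l l_pr b; last by exists a; rewrite zE bE.
exists q => //; rewrite -(fmorph_root iota) -map_poly_comp -zE.
exact: qz.
Qed.

(** The inverse Fourier transform of the values is integral, since p^k is invertible
    in Z_l, and Galois-invariant, so its coefficients lie in Z_l. *)
Lemma quot_interpolation U : exists f : group_ring Zl (os_quot U),
  forall w, {subset U <= char_ker w} -> quot_eval w f = orbit_value w.
Proof.
have [D [D_uniq DE]] := finite_dual (@quot_full U) (@quot_size_inv U).
pose n := size (@quot_enum Gamma U).
pose f x : Qlbar :=
  n%:R^-1 * \sum_(w <- D) orbit_value w * quot_char (U := U) w (- x).
have f_interp w : {subset U <= char_ker w} ->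
    \sum_(x <- @quot_enum Gamma U) f x * quot_char w x = orbit_value w.
  move=> /DE wD; apply: fourier_interpolation wD => //.
  - exact: quot_enum_uniq.
  - exact: quot_full.
  - exact: quot_size_inv.
  - by move=> v /DE; exact: quot_char_is_char.
  move=> v v' /DE Uv /DE Uv' neq_v; apply: contrapT => no_x.
  move/eqP: neq_v; apply.
  apply: (quot_char_inj Uv Uv'); apply/funext => x; apply: contrapT => /eqP vx.
  by apply: no_x; exists x.
have f_integral x : integralOver j (f x).
  apply: integral_mul.
    have [_ [k nE]] := pro_p_quot Gamma_pro_p U.
    have [b bE] := padic_prime_unit l_pr k p_pr neq_lp.
    have -> : n%:R^-1 = j b; last exact: integral_id.
    apply: (mulIf (quot_size_inv U)); rewrite mulVf ?quot_size_inv//.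
    by rewrite nE -(rmorph_nat j) -rmorphM bE rmorph1.
  elim/big_ind: _ => [|u v|w _]; first by rewrite -(rmorph0 j); exact: integral_id.
    exact: integral_add.
  apply: integral_mul; first exact: orbit_value_integral.
  have := adjoin_generator (S := range w) j (z := quot_char (U := U) w (- x)).
  move=> /(_ (ex_intro2 _ _ _ I erefl)); apply: adjoin_integral => _ [u _ <-].
  exact: char_root_of_unity.
have /choice[b bE] x :=
  integral_fixed (f_integral x) (fun s => interpolation_gal s f_interp x).
have b_fin : b \in @finite_supp Zl (os_quot U).
  apply/finite_suppP; apply: sub_finite_set (subsetT _) _.
  have [_ _ _ /(_ U)[k Uk]] := Gamma_pro_p.
  by apply/finite_setP; exists (p ^ k)%N.
exists (GroupRing b_fin) => w /f_interp <-; apply: eq_bigr => x _.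
by rewrite bE.
Qed.

(** The interpolating elements of the various levels are compatible by
    uniqueness. *)
Lemma orbit_eval_surj : exists x, orbit_eval x = y.
Proof.
pose f : dprod (fun U => group_ring Zl (os_quot U)) :=
  fun U => projT1 (cid (quot_interpolation U)).
have fE U w : {subset U <= char_ker w} -> quot_eval w (f U) = orbit_value w.
  by rewrite /f; case: cid => g /= gE; exact: gE.
have f_compat : f \in
    @compatible (open_subgroup Gamma) (fun U V => {subset V <= U}) _
      (fun U V sVU => group_ring_map (os_quot_map sVU)).
  apply/compatibleP => U V sVU; apply: quot_eval_inj => w Uw.
  by rewrite quot_eval_map// !fE// => z /sVU; exact: Uw.
exists (InvLim f_compat : Lambda); apply: dprodP => c; apply: val_inj.
by rewrite -orbit_value_repr -(fE (char_ker (repr c))).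
Qed.

End Preimage.

Lemma completed_group_ring_orbits : ring_isomorphic Lambda
  (dprod (fun c : orbit => adjoin (padic_embed iota) (orbit_image c))).
Proof.
apply: (@ring_isomorphic_of _ _ orbit_eval).
- move=> x y; apply: dprodP => c; apply: val_inj; exact: char_eval_zmod_morphism.
- split=> [|x y]; apply: dprodP => c; apply: val_inj;
    have [ev1 evM] := char_eval_monoid_morphism (repr c); [exact: ev1 | exact: evM].
have [g gK] := choice orbit_eval_surj.
by exists g => // x; apply: orbit_eval_inj; rewrite gK.
Qed.

End MainIsomorphism.

Theorem theorem1p1 (l p : nat) (l_pr : prime l) (p_pr : prime p) (neq_lp : l <> p)
  (Gamma : topologicalZmodType) (Gamma_pro_p : pro_p_group p Gamma)
  (Qlbar : closedFieldType) (iota : {rmorphism padic_field l_pr -> Qlbar})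
  (iota_alg : algebraic_extension iota) :
  ring_isomorphic
    (completed_group_ring (padic_int l_pr) Gamma)
    (dprod (fun c : char_orbit Gamma iota =>
       adjoin (padic_embed iota) (orbit_image c)))
  /\
  ring_isomorphic
    (dprod (fun c : char_orbit Gamma iota =>
       adjoin (padic_embed iota) (orbit_image c)))
    (dprod (fun n : nat =>
       dprod (fun c : {c : char_orbit Gamma iota |
                        orbit_image c = mu Qlbar (p ^ n)} =>
         adjoin (padic_embed iota) (mu Qlbar (p ^ n))))).
Proof.
split; first exact: (completed_group_ring_orbits p_pr).
have char0 := Qlbar_char0 iota.
apply: (@dprod_fibre_isomorphic _ _ _ _ _ _ (fun n => mu Qlbar (p ^ n))).
  by move=> c; exact: (character_image p_pr Gamma_pro_p (repr c)).
by move=> m n; exact: mu_inj.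
Qed.
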